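(* The sharp $\mathscr{S}^*_\wp$-radii are: (i) $R_{\mathscr{S}^*_\wp}(\mathcal{S}^*_L)=(2e-1)/e^2\approx0.600423$; (ii) $R_{\mathscr{S}^*_\wp}(\mathcal{S}^*_{RL})=\dfrac{1+2(\sqrt2-1)e}{e^2(\sqrt2-1)\left(\sqrt2-1+2(\sqrt2-1+e^{-1})^2\right)}\approx0.648826$; (iii) $R_{\mathscr{S}^*_\wp}(\mathcal{S}^*_e)=1-\ln(e-1)\approx0.458675$; (iv) $R_{\mathscr{S}^*_\wp}(\mathcal{S}^*_C)=1-\sqrt{1-3/(2e)}\approx0.330536$; (v) $R_{\mathscr{S}^*_\wp}(\mathcal{S}^*_s)=\arcsin(1/e)\approx0.376727$; (vi) $R_{\mathscr{S}^*_\wp}(\Delta^* )=(2e-1)/(2e(e-1))\approx0.474928$.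
   Context: $\mathbb{D}$ is the unit disk; $\mathcal{A}$ is the class of analytic $f$ on $\mathbb{D}$ with $f(0)=0,f'(0)=1$. $f\prec g$ means $f=g\circ\omega$ for analytic $\omega:\mathbb{D}\to\mathbb{D}$, $\omega(0)=0$. For analytic $\psi$, $\mathcal{S}^*(\psi)=\{f\in\mathcal{A}:zf'/f\prec\psi\}$. $\wp(z)=1+ze^z$, $\mathscr{S}^*_\wp=\mathcal{S}^*(\wp)$. Further $\mathcal{S}^*_L=\mathcal{S}^*(\sqrt{1+z})$, $\mathcal{S}^*_{RL}=\mathcal{S}^*\big(\sqrt2-(\sqrt2-1)\sqrt{(1-z)/(1+2(\sqrt2-1)z)}\big)$, $\mathcal{S}^*_e=\mathcal{S}^*(e^z)$, $\mathcal{S}^*_C=\mathcal{S}^*(1+\tfrac43z+\tfrac23z^2)$, $\mathcal{S}^*_s=\mathcal{S}^*(1+\sin z)$, $\Delta^*=\mathcal{S}^*(z+\sqrt{1+z^2})$ (principal branches). For classes $G_1,G_2$, $R_{G_1}(G_2)$ is the largest $r_0\in(0,1]$ such that $r^{-1}f(rz)\in G_1$ for all $0<r\le r_0$ and all $f\in G_2$; ''sharp'' means it cannot be increased. *)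

(* Defs.v *)
From Stdlib Require Import Reals.
From Coquelicot Require Import Coquelicot.
Open Scope R_scope.

Definition inD (z : C) : Prop := Cmod z < 1.

Definition analytic_D (f : C -> C) : Prop :=
  forall z : C, inD z -> exists l : C, is_derive (K := C_AbsRing) (V := C_NormedModule) f z l.

Definition classA (f : C -> C) : Prop :=
  analytic_D f /\ f (RtoC 0) = (RtoC 0) /\ is_derive (K := C_AbsRing) (V := C_NormedModule) f (RtoC 0) (RtoC 1).

Definition subord (f g : C -> C) : Prop :=
  exists w : C -> C, analytic_D w /\ w (RtoC 0) = (RtoC 0) /\
    (forall z, inD z -> inD (w z)) /\ (forall z, inD z -> f z = g (w z)).

(* S*(psi): f in A with z f'(z)/f(z) ≺ psi.  The function z f'/f is taken with its
   removable value 1 at z = 0, and f(z) <> 0 for z <> 0 is required so that the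
   quotient is meaningful. *)
Definition starlike (psi : C -> C) (f : C -> C) : Prop :=
  classA f /\
  exists df : C -> C,
    (forall z, inD z -> is_derive (K := C_AbsRing) (V := C_NormedModule) f z (df z)) /\
    (forall z, inD z -> z <> (RtoC 0) -> f z <> (RtoC 0)) /\
    subord (fun z => if Ceq_dec z (RtoC 0) then (RtoC 1) else (z * df z / f z)%C) psi.

Definition radius_prop (G1 G2 : (C -> C) -> Prop) (r : R) : Prop :=
  forall f, G2 f -> G1 (fun z => (f (RtoC r * z) / RtoC r)%C).

Definition is_radius (G1 G2 : (C -> C) -> Prop) (r0 : R) : Prop :=
  0 < r0 <= 1 /\
  (forall r, 0 < r <= r0 -> radius_prop G1 G2 r) /\
  (forall r1, r0 < r1 <= 1 -> ~ (forall r, 0 < r <= r1 -> radius_prop G1 G2 r)).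

Definition Cexp (z : C) : C := (RtoC (exp (Re z)) * (cos (Im z), sin (Im z)))%C.
Definition Ci : C := (0, 1).
Definition Csin (z : C) : C := ((Cexp (Ci * z) - Cexp (- (Ci * z))) / (2 * Ci))%C.
(* principal square root: nonnegative real part, branch cut on (-oo,0) *)
Definition Csqrt (z : C) : C :=
  (sqrt ((Cmod z + Re z) / 2),
   (if Rlt_dec (Im z) 0 then -1 else 1) * sqrt ((Cmod z - Re z) / 2)).

Definition wp (z : C) : C := (1 + z * Cexp z)%C.
Definition psiL (z : C) : C := Csqrt (1 + z)%C.
Definition psiRL (z : C) : C :=
  (RtoC (sqrt 2) - RtoC (sqrt 2 - 1) *
     Csqrt ((1 - z) / (1 + RtoC (2 * (sqrt 2 - 1)) * z)))%C.
Definition psie (z : C) : C := Cexp z.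
Definition psiC (z : C) : C := (1 + RtoC (4/3) * z + RtoC (2/3) * (z * z))%C.
Definition psis (z : C) : C := (1 + Csin z)%C.
Definition psiD (z : C) : C := (z + Csqrt (1 + z * z))%C.

(* Main.v *)
(* Let [h(z) = z e^z], so that [wp = 1 + h]. The domain [h(D)] has a cusp at [-1/e], pointing
   inwards, and contains the disk [B] of centre 1 and radius [1 + 1/e], whose boundary passes
   through the cusp. Since [h] is injective on the unit disk, it has an analytic inverse [V] on
   [B]. If [psi - 1] maps [|z| < r0] into [B], then for [f] in [S*(psi)] with Schwarz function [w]
   and [r <= r0] the function [V (psi (w (r z)) - 1)] witnesses the subordination to [wp], because
   [|w (r z)| < r0] by the Schwarz lemma. In all six cases [psi (- r0) - 1] is the cusp, a value
   that [h] omits on the disk, so the function with [z f'(z) / f(z) = psi(z)] shows that [r0]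
   cannot be increased. *)
Require Import Defs.
From Stdlib Require Import Reals Lra Lia Psatz Classical ClassicalEpsilon.
From Coquelicot Require Import Coquelicot.
Open Scope R_scope.

(** * Complex differentiation *)

Notation cderiv := (is_derive (K := C_AbsRing) (V := C_NormedModule)).

Lemma cderiv_iff (f : C -> C) (p l : C) :
  cderiv f p l <->
  forall eps, 0 < eps -> exists delta, 0 < delta /\
    forall z : C, Cmod (z - p)%C < delta ->
      Cmod (f z - f p - (z - p) * l)%C <= eps * Cmod (z - p)%C.
Proof.
  split.
  - intros [_ H] eps He.
    destruct (H p (fun P HP => HP) (mkposreal eps He)) as [d Hd].
    exists d; split; [apply cond_pos|].
    intros z Hz. exact (Hd z Hz).
  - intros H; split.
    + apply (is_linear_scal_l (K := C_AbsRing) (V := C_NormedModule) l).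
    + intros x Hx.
      apply (is_filter_lim_locally_unique (K := C_AbsRing) (V := AbsRing_NormedModule C_AbsRing)) in Hx.
      subst x. intros eps.
      destruct (H eps (cond_pos eps)) as [d [Hd0 Hd]].
      exists (mkposreal d Hd0). intros z Hz. exact (Hd z Hz).
Qed.

Definition ccont (f : C -> C) (p : C) : Prop :=
  forall eps, 0 < eps -> exists delta, 0 < delta /\
    forall z : C, Cmod (z - p)%C < delta -> Cmod (f z - f p)%C < eps.

Lemma ccont_ext_loc (f g : C -> C) (p : C) (d : R) : 0 < d ->
  (forall z, Cmod (z - p)%C < d -> f z = g z) -> ccont f p -> ccont g p.
Proof.
  intros Hd E Hf eps He. destruct (Hf eps He) as [d1 [Hd1 H1]].
  exists (Rmin d d1); split; [now apply Rmin_pos|].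
  intros z Hz. rewrite <- !E.
  - apply H1. eapply Rlt_le_trans; [exact Hz|apply Rmin_r].
  - unfold Cminus; rewrite Cplus_opp_r, Cmod_0; exact Hd.
  - eapply Rlt_le_trans; [exact Hz|apply Rmin_l].
Qed.

Lemma ccont_const (c p : C) : ccont (fun _ => c) p.
Proof.
  intros eps He; exists 1; split; [lra|]; intros z _.
  unfold Cminus; rewrite Cplus_opp_r, Cmod_0; exact He.
Qed.

Lemma ccont_id (p : C) : ccont (fun z => z) p.
Proof. intros eps He; exists eps; split; auto. Qed.

Lemma ccont_plus (f g : C -> C) (p : C) :
  ccont f p -> ccont g p -> ccont (fun z => (f z + g z)%C) p.
Proof.
  intros Hf Hg eps He.
  destruct (Hf (eps / 2) ltac:(lra)) as [d1 [Hd1 H1]].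
  destruct (Hg (eps / 2) ltac:(lra)) as [d2 [Hd2 H2]].
  exists (Rmin d1 d2); split; [now apply Rmin_pos|]. intros z Hz.
  replace (f z + g z - (f p + g p))%C with ((f z - f p) + (g z - g p))%C by ring.
  eapply Rle_lt_trans; [apply Cmod_triangle|].
  specialize (H1 z ltac:(eapply Rlt_le_trans; [exact Hz|apply Rmin_l])).
  specialize (H2 z ltac:(eapply Rlt_le_trans; [exact Hz|apply Rmin_r])).
  lra.
Qed.

Lemma ccont_bounded (f : C -> C) (p : C) : ccont f p ->
  exists d, 0 < d /\ forall z, Cmod (z - p)%C < d -> Cmod (f z) <= Cmod (f p) + 1.
Proof.
  intros Hf. destruct (Hf 1 ltac:(lra)) as [d [Hd H]].
  exists d; split; auto. intros z Hz. specialize (H z Hz).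
  replace (f z) with ((f z - f p) + f p)%C by ring.
  generalize (Cmod_triangle (f z - f p) (f p))%C; lra.
Qed.

Lemma ccont_mult (f g : C -> C) (p : C) :
  ccont f p -> ccont g p -> ccont (fun z => (f z * g z)%C) p.
Proof.
  intros Hf Hg eps He.
  destruct (ccont_bounded f p Hf) as [d0 [Hd0 H0]].
  pose (A := Cmod (f p) + 1). pose (B := Cmod (g p) + 1).
  assert (HA : 0 < A) by (unfold A; generalize (Cmod_ge_0 (f p)); lra).
  assert (HB : 0 < B) by (unfold B; generalize (Cmod_ge_0 (g p)); lra).
  destruct (Hf (eps / 2 / B)) as [d1 [Hd1 H1]].
  { apply Rdiv_lt_0_compat; lra. }
  destruct (Hg (eps / 2 / A)) as [d2 [Hd2 H2]].
  { apply Rdiv_lt_0_compat; lra. }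
  exists (Rmin d0 (Rmin d1 d2)); split; [repeat apply Rmin_pos; auto|].
  intros z Hz. apply Rmin_Rgt_l in Hz as [Hz0 Hz]. apply Rmin_Rgt_l in Hz as [Hz1 Hz2].
  replace (f z * g z - f p * g p)%C with (f z * (g z - g p) + (f z - f p) * g p)%C by ring.
  eapply Rle_lt_trans; [apply Cmod_triangle|]. rewrite !Cmod_mult.
  specialize (H0 z Hz0). specialize (H1 z Hz1). specialize (H2 z Hz2). fold A in H0.
  assert (E1 : Cmod (f z) * Cmod (g z - g p)%C <= A * (eps / 2 / A)).
  { apply Rmult_le_compat; try apply Cmod_ge_0; lra. }
  assert (E2 : Cmod (f z - f p)%C * Cmod (g p) < (eps / 2 / B) * B).
  { apply Rle_lt_trans with ((eps / 2 / B) * Cmod (g p)).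
    - apply Rmult_le_compat_r; [apply Cmod_ge_0|lra].
    - apply Rmult_lt_compat_l; [apply Rdiv_lt_0_compat; lra|unfold B; lra]. }
  replace (A * (eps / 2 / A)) with (eps / 2) in E1 by (field; lra).
  replace (eps / 2 / B * B) with (eps / 2) in E2 by (field; lra).
  lra.
Qed.

Lemma ccont_comp (f g : C -> C) (p : C) :
  ccont f p -> ccont g (f p) -> ccont (fun z => g (f z)) p.
Proof.
  intros Hf Hg eps He. destruct (Hg eps He) as [d [Hd H]].
  destruct (Hf d Hd) as [d' [Hd' H']].
  exists d'; split; auto.
Qed.

Lemma ccont_nonzero (f : C -> C) (p : C) : ccont f p -> f p <> 0%C ->
  exists d, 0 < d /\ forall z, Cmod (z - p)%C < d -> Cmod (f p) / 2 < Cmod (f z).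
Proof.
  intros Hf Hp. apply Cmod_gt_0 in Hp.
  destruct (Hf (Cmod (f p) / 2) ltac:(lra)) as [d [Hd H]].
  exists d; split; auto. intros z Hz. specialize (H z Hz).
  assert (E : Cmod (f p) <= Cmod (f z) + Cmod (f z - f p)%C).
  { replace (f p) with (f z + - (f z - f p))%C at 1 by ring.
    eapply Rle_trans; [apply Cmod_triangle|]. rewrite Cmod_opp. lra. }
  lra.
Qed.

Lemma ccont_inv (f : C -> C) (p : C) : ccont f p -> f p <> 0%C ->
  ccont (fun z => (/ f z)%C) p.
Proof.
  intros Hf Hp eps He.
  destruct (ccont_nonzero f p Hf Hp) as [d0 [Hd0 H0]].
  pose proof (proj1 (Cmod_gt_0 _) Hp) as Hm. set (m := Cmod (f p)) in *.
  destruct (Hf (eps * (m * m / 2))) as [d1 [Hd1 H1]]; [apply Rmult_lt_0_compat; [lra|nra]|].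
  exists (Rmin d0 d1); split; [now apply Rmin_pos|].
  intros z Hz. apply Rmin_Rgt_l in Hz as [Hz0 Hz1].
  specialize (H0 z Hz0). specialize (H1 z Hz1).
  assert (Hz : f z <> 0%C) by (apply Cmod_gt_0; lra).
  replace (/ f z - / f p)%C with (- (f z - f p) * / (f z * f p))%C by (field; auto).
  rewrite Cmod_mult, Cmod_opp, Cmod_inv, Cmod_mult by (apply Cmult_neq_0; auto).
  fold m.
  assert (Hmm : m * m / 2 < Cmod (f z) * m) by nra.
  assert (Hpos : 0 < m * m / 2) by nra.
  apply Rmult_lt_reg_r with (Cmod (f z) * m); [lra|].
  rewrite Rmult_assoc, Rinv_l, Rmult_1_r by lra. nra.
Qed.

Lemma ccont_opp (f : C -> C) (p : C) : ccont f p -> ccont (fun z => (- f z)%C) p.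
Proof.
  intros Hf eps He. destruct (Hf eps He) as [d [Hd H]]. exists d; split; auto.
  intros z Hz. replace (- f z - - f p)%C with (- (f z - f p))%C by ring.
  rewrite Cmod_opp; auto.
Qed.

(* Caratheodory's form of differentiability reduces the differentiation rules to
   the algebra of continuous functions. *)
Lemma cderiv_slope (f : C -> C) (p l : C) : cderiv f p l ->
  exists q : C -> C, ccont q p /\ q p = l /\ forall z, f z = (f p + (z - p) * q z)%C.
Proof.
  intros H. rewrite cderiv_iff in H.
  exists (fun z => if Ceq_dec z p then l else ((f z - f p) / (z - p))%C).
  assert (E : forall z, z <> p -> (z - p)%C <> 0%C).
  { intros z Hz Hc. apply Hz. replace z with ((z - p) + p)%C by ring. rewrite Hc; ring. }
  split; [|split].
  - intros eps He. destruct (H (eps / 2) ltac:(lra)) as [d [Hd Hd']].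
    exists d; split; auto. intros z Hz.
    destruct (Ceq_dec p p) as [_|]; [|congruence].
    destruct (Ceq_dec z p) as [->|Hzp].
    + unfold Cminus; rewrite Cplus_opp_r, Cmod_0; exact He.
    + specialize (Hd' z Hz). specialize (E z Hzp).
      replace ((f z - f p) / (z - p) - l)%C with ((f z - f p - (z - p) * l) * / (z - p))%C
        by (field; auto).
      rewrite Cmod_mult, Cmod_inv by auto. apply Cmod_gt_0 in E.
      apply Rle_lt_trans with (eps / 2 * Cmod (z - p)%C * / Cmod (z - p)%C).
      * apply Rmult_le_compat_r; auto. left; now apply Rinv_0_lt_compat.
      * rewrite Rmult_assoc, Rinv_r by lra. lra.
  - destruct (Ceq_dec p p); congruence.
  - intros z. destruct (Ceq_dec z p) as [->|Hzp]; [ring|field; auto].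
Qed.

Lemma slope_cderiv (f q : C -> C) (p : C) : ccont q p ->
  (exists d, 0 < d /\ forall z, Cmod (z - p)%C < d -> f z = (f p + (z - p) * q z)%C) ->
  cderiv f p (q p).
Proof.
  intros Hq [d [Hd E]]. apply cderiv_iff. intros eps He.
  destruct (Hq eps He) as [d' [Hd' H]].
  exists (Rmin d d'); split; [now apply Rmin_pos|].
  intros z Hz. apply Rmin_Rgt_l in Hz as [Hz0 Hz1].
  rewrite (E z Hz0).
  replace (f p + (z - p) * q z - f p - (z - p) * q p)%C with ((q z - q p) * (z - p))%C by ring.
  rewrite Cmod_mult. apply Rmult_le_compat_r; [apply Cmod_ge_0|]. left; auto.
Qed.

Lemma slope_cderiv_all (f q : C -> C) (p l : C) : ccont q p -> q p = l ->
  (forall z, f z = (f p + (z - p) * q z)%C) -> cderiv f p l.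
Proof.
  intros Hq <- E. apply slope_cderiv; auto. exists 1; split; [lra|auto].
Qed.

Lemma cderiv_cont (f : C -> C) (p l : C) : cderiv f p l -> ccont f p.
Proof.
  intros H. destruct (cderiv_slope f p l H) as [q [Hq [_ E]]].
  apply (ccont_ext_loc (fun z => f p + (z + - p) * q z)%C f p 1); [lra| |].
  - intros z _. rewrite (E z). reflexivity.
  - apply ccont_plus; [apply ccont_const|]. apply ccont_mult; auto.
    apply ccont_plus; [apply ccont_id|apply ccont_const].
Qed.

Lemma cderiv_ext_loc (f g : C -> C) (p l : C) (d : R) : 0 < d ->
  (forall z, Cmod (z - p)%C < d -> f z = g z) -> cderiv f p l -> cderiv g p l.
Proof.
  intros Hd E. rewrite !cderiv_iff. intros Hf eps He.
  destruct (Hf eps He) as [d1 [Hd1 H1]].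
  exists (Rmin d d1); split; [now apply Rmin_pos|].
  intros z Hz. apply Rmin_Rgt_l in Hz as [Hz0 Hz1]. rewrite <- !E; auto.
  unfold Cminus; rewrite Cplus_opp_r, Cmod_0; exact Hd.
Qed.

Lemma cderiv_val (f : C -> C) (p l l' : C) : l = l' -> cderiv f p l -> cderiv f p l'.
Proof. now intros ->. Qed.

Lemma cderiv_const (c p : C) : cderiv (fun _ => c) p (RtoC 0).
Proof.
  apply slope_cderiv_all with (fun _ => 0%C); auto using ccont_const. intros; ring.
Qed.

Lemma cderiv_id (p : C) : cderiv (fun z => z) p (RtoC 1).
Proof.
  apply slope_cderiv_all with (fun _ => 1%C); auto using ccont_const. intros; ring.
Qed.

Lemma cderiv_plus (f g : C -> C) (p l k : C) : cderiv f p l -> cderiv g p k ->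
  cderiv (fun z => (f z + g z)%C) p (l + k)%C.
Proof.
  intros Hf Hg.
  destruct (cderiv_slope _ _ _ Hf) as [q [Hq [<- E]]].
  destruct (cderiv_slope _ _ _ Hg) as [q' [Hq' [<- E']]].
  apply slope_cderiv_all with (fun z => q z + q' z)%C; auto using ccont_plus.
  intros z. rewrite (E z), (E' z). ring.
Qed.

Lemma cderiv_mult (f g : C -> C) (p l k : C) : cderiv f p l -> cderiv g p k ->
  cderiv (fun z => (f z * g z)%C) p (l * g p + f p * k)%C.
Proof.
  intros Hf Hg. pose proof (cderiv_cont _ _ _ Hg) as Hc.
  destruct (cderiv_slope _ _ _ Hf) as [q [Hq [<- E]]].
  destruct (cderiv_slope _ _ _ Hg) as [q' [Hq' [<- E']]].
  apply slope_cderiv_all with (fun z => q z * g z + f p * q' z)%C; auto.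
  - apply ccont_plus; apply ccont_mult; auto using ccont_const.
  - intros z. rewrite (E z), (E' z). ring.
Qed.

Lemma cderiv_comp (f g : C -> C) (p l k : C) : cderiv f p l -> cderiv g (f p) k ->
  cderiv (fun z => g (f z)) p (l * k)%C.
Proof.
  intros Hf Hg. pose proof (cderiv_cont _ _ _ Hf) as Hc.
  destruct (cderiv_slope _ _ _ Hf) as [q [Hq [<- E]]].
  destruct (cderiv_slope _ _ _ Hg) as [q' [Hq' [<- E']]].
  apply slope_cderiv_all with (fun z => q z * q' (f z))%C; auto.
  - apply ccont_mult; auto. apply (ccont_comp f q'); auto.
  - intros z. rewrite (E' (f z)), (E z). ring.
Qed.

Lemma cderiv_inv (f : C -> C) (p l : C) : cderiv f p l -> f p <> 0%C ->
  cderiv (fun z => (/ f z)%C) p (- l / (f p * f p))%C.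
Proof.
  intros Hf H0. pose proof (cderiv_cont _ _ _ Hf) as Hc.
  destruct (cderiv_slope _ _ _ Hf) as [q [Hq [<- E]]].
  destruct (ccont_nonzero f p Hc H0) as [d [Hd Hd']].
  apply (slope_cderiv (fun z => / f z)%C (fun z => - q z * / (f z * f p))%C).
  - apply ccont_mult; [now apply ccont_opp|]. apply ccont_inv.
    + apply ccont_mult; auto using ccont_const.
    + now apply Cmult_neq_0.
  - exists d; split; auto. intros z Hz.
    assert (Hz0 : f z <> 0%C).
    { apply Cmod_gt_0. specialize (Hd' z Hz). apply Cmod_gt_0 in H0; lra. }
    assert (E2 : ((z - p) * q z = f z - f p)%C) by (rewrite (E z); ring).
    transitivity (/ f p - ((z - p) * q z) * / (f z * f p))%C; [|ring].
    rewrite E2. field; auto.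
Qed.

Lemma cderiv_opp (f : C -> C) (p l : C) : cderiv f p l ->
  cderiv (fun z => (- f z)%C) p (- l)%C.
Proof.
  intros Hf. destruct (cderiv_slope _ _ _ Hf) as [q [Hq [<- E]]].
  apply slope_cderiv_all with (fun z => - q z)%C; auto using ccont_opp.
  intros z. rewrite (E z). ring.
Qed.

Lemma cderiv_minus (f g : C -> C) (p l k : C) : cderiv f p l -> cderiv g p k ->
  cderiv (fun z => (f z - g z)%C) p (l - k)%C.
Proof. intros; now apply cderiv_plus; [|apply cderiv_opp]. Qed.

Lemma cderiv_scal (c : C) (f : C -> C) (p l : C) : cderiv f p l ->
  cderiv (fun z => (c * f z)%C) p (c * l)%C.
Proof.
  intros Hf. eapply cderiv_val; [|apply cderiv_mult; [apply cderiv_const|exact Hf]].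
  cbv beta; ring.
Qed.

Lemma cderiv_div (f g : C -> C) (p l k : C) : cderiv f p l -> cderiv g p k -> g p <> 0%C ->
  cderiv (fun z => (f z / g z)%C) p ((l * g p - f p * k) / (g p * g p))%C.
Proof.
  intros Hf Hg H0.
  eapply cderiv_val; [|apply cderiv_mult; [exact Hf|apply cderiv_inv; eauto]].
  cbv beta; field; auto.
Qed.

Lemma cderiv_unique (f : C -> C) (p l k : C) : cderiv f p l -> cderiv f p k -> l = k.
Proof.
  intros H1 H2. rewrite <- (is_C_derive_unique _ _ _ H1). now apply is_C_derive_unique.
Qed.

Lemma cderiv_right_inverse (h V : C -> C) (u k : C) :
  ccont V u -> cderiv h (V u) k -> k <> 0%C ->
  (exists d, 0 < d /\ forall z, Cmod (z - u)%C < d -> h (V z) = z) ->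
  cderiv V u (/ k)%C.
Proof.
  intros HV Hh Hk [d [Hd E]].
  destruct (cderiv_slope _ _ _ Hh) as [q [Hq [<- Eh]]].
  pose proof (ccont_comp V q u HV Hq) as Hc.
  destruct (ccont_nonzero _ u Hc Hk) as [d1 [Hd1 H1]].
  apply (slope_cderiv V (fun z => / q (V z))%C).
  - now apply (ccont_inv (fun z => q (V z))).
  - exists (Rmin d d1); split; [now apply Rmin_pos|].
    intros z Hz. apply Rmin_Rgt_l in Hz as [Hz0 Hz1].
    assert (Hn : q (V z) <> 0%C).
    { apply Cmod_gt_0. specialize (H1 z Hz1). apply Cmod_gt_0 in Hk; lra. }
    assert (E1 : (z - u = (V z - V u) * q (V z))%C).
    { rewrite <- (E z Hz0) at 1. rewrite <- (E u) at 1.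
      - rewrite (Eh (V z)). ring.
      - unfold Cminus; rewrite Cplus_opp_r, Cmod_0; exact Hd. }
    rewrite E1. field; auto.
Qed.

(** * The function [z e^z] *)

Lemma nonneg_of_derive (f f' : R -> R) :
  (forall t, 0 <= t -> is_derive f t (f' t)) ->
  (forall t, 0 <= t -> 0 <= f' t) -> 0 <= f 0 ->
  forall x, 0 <= x -> 0 <= f x.
Proof.
  intros Hd Hp H0 x Hx.
  destruct (MVT_gen f 0 x f') as [c [Hc E]].
  - intros t Ht. rewrite Rmin_left, Rmax_right in Ht by lra. apply Hd; lra.
  - intros t Ht. rewrite Rmin_left, Rmax_right in Ht by lra.
    apply derivable_continuous_pt. exists (f' t). apply is_derive_Reals, Hd; lra.
  - rewrite Rmin_left, Rmax_right in Hc by lra.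
    specialize (Hp c ltac:(lra)). nra.
Qed.

Lemma exp_ge_2 x : 0 <= x -> 1 + x + x ^ 2 / 2 <= exp x.
Proof.
  intros Hx. enough (0 <= exp x - (1 + x + x ^ 2 / 2)) by lra. revert x Hx.
  apply nonneg_of_derive with (fun t => exp t - (1 + t)).
  - intros t _. auto_derive; [easy|field].
  - intros t _. generalize (exp_ineq1_le t); lra.
  - rewrite exp_0; lra.
Qed.

Lemma exp_opp_le_2 x : 0 <= x -> exp (- x) <= 1 - x + x ^ 2 / 2.
Proof.
  intros Hx. enough (0 <= (1 - x + x ^ 2 / 2) - exp (- x)) by lra. revert x Hx.
  apply nonneg_of_derive with (fun t => -1 + t + exp (- t)).
  - intros t _. auto_derive; [easy|field].
  - intros t _. generalize (exp_ineq1_le (- t)); lra.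
  - rewrite Ropp_0, exp_0; lra.
Qed.

Lemma exp_opp_ge_3 x : 0 <= x -> 1 - x + x ^ 2 / 2 - x ^ 3 / 6 <= exp (- x).
Proof.
  intros Hx. enough (0 <= exp (- x) - (1 - x + x ^ 2 / 2 - x ^ 3 / 6)) by lra. revert x Hx.
  apply nonneg_of_derive with (fun t => (1 - t + t ^ 2 / 2) - exp (- t)).
  - intros t _. auto_derive; [easy|field].
  - intros t Ht. generalize (exp_opp_le_2 t Ht); lra.
  - rewrite Ropp_0, exp_0; lra.
Qed.

Lemma sin_le_id x : 0 <= x -> sin x <= x.
Proof.
  intros Hx. enough (0 <= x - sin x) by lra. revert x Hx.
  apply nonneg_of_derive with (fun t => 1 - cos t).
  - intros t _. auto_derive; [easy|field].
  - intros t _. generalize (COS_bound t); lra.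
  - rewrite sin_0; lra.
Qed.

Lemma cos_ge_2 x : 1 - x ^ 2 / 2 <= cos x.
Proof.
  assert (P : forall y, 0 <= y -> 1 - y ^ 2 / 2 <= cos y).
  { intros y Hy. enough (0 <= cos y - (1 - y ^ 2 / 2)) by lra. revert y Hy.
    apply nonneg_of_derive with (fun t => t - sin t).
    - intros t _. auto_derive; [easy|field].
    - intros t Ht. generalize (sin_le_id t Ht); lra.
    - rewrite cos_0; lra. }
  destruct (Rle_dec 0 x) as [H|H]; [now apply P|].
  rewrite <- cos_neg. replace (x ^ 2) with ((- x) ^ 2) by ring. apply P; lra.
Qed.

Lemma sin_ge_3 x : 0 <= x -> x - x ^ 3 / 6 <= sin x.
Proof.
  intros Hx. enough (0 <= sin x - (x - x ^ 3 / 6)) by lra. revert x Hx.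
  apply nonneg_of_derive with (fun t => cos t - (1 - t ^ 2 / 2)).
  - intros t _. auto_derive; [easy|field].
  - intros t _. generalize (cos_ge_2 t); lra.
  - rewrite sin_0; lra.
Qed.

Lemma Derive_n_exp n t : Derive_n exp n t = exp t.
Proof.
  revert t; induction n as [|n IH]; intros t; [reflexivity|].
  simpl. rewrite (Derive_ext _ exp _ IH). apply is_derive_unique.
  auto_derive; [easy|ring].
Qed.

Lemma exp_1_bounds : 2.718 < exp 1 < 2.719.
Proof.
  destruct (Taylor_Lagrange exp 6 0 1 ltac:(lra)) as [z [Hz E]].
  { intros t _ [|k] _; [exact I|]. simpl.
    apply (ex_derive_ext exp); [intros; symmetry; apply Derive_n_exp|].
    auto_derive; easy. }
  pose proof exp_le_3. pose proof (exp_increasing z 1 ltac:(lra)).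
  pose proof (exp_pos z).
  rewrite Derive_n_exp in E.
  rewrite (sum_eq _ (fun m => (1 - 0) ^ m / INR (Factorial.fact m))) in E.
  2:{ intros i _. rewrite Derive_n_exp, exp_0. ring. }
  simpl in E. lra.
Qed.

Lemma inv_exp_1_bounds : 0.3677 < / exp 1 < 0.368.
Proof.
  pose proof exp_1_bounds.
  split; apply Rmult_lt_reg_r with (exp 1); try rewrite Rinv_l; lra.
Qed.

Lemma Cmod_sqr (z : C) : Cmod z * Cmod z = Re z * Re z + Im z * Im z.
Proof. generalize (Cmod2_alt z); simpl; lra. Qed.

Lemma Cmod_lt_sqr (z : C) (r : R) : 0 <= r -> Re z * Re z + Im z * Im z < r * r -> Cmod z < r.
Proof. intros Hr H. generalize (Cmod_sqr z) (Cmod_ge_0 z); nra. Qed.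

Lemma Cmod_le_sqr (z : C) (r : R) : 0 <= r -> Re z * Re z + Im z * Im z <= r * r -> Cmod z <= r.
Proof. intros Hr H. generalize (Cmod_sqr z) (Cmod_ge_0 z); nra. Qed.

Lemma im_le_Cmod (z : C) : Rabs (Im z) <= Cmod z.
Proof. eapply Rle_trans; [apply Rmax_r|apply (Rmax_Cmod z)]. Qed.

Lemma Cmod_le_abs (z : C) : Cmod z <= Rabs (Re z) + Rabs (Im z).
Proof.
  apply Cmod_le_sqr.
  - generalize (Rabs_pos (Re z)) (Rabs_pos (Im z)); lra.
  - generalize (Rabs_pos (Re z)) (Rabs_pos (Im z)) (Rsqr_abs (Re z)) (Rsqr_abs (Im z)).
    unfold Rsqr; nra.
Qed.

Lemma Re_minus (a b : C) : Re (a - b)%C = Re a - Re b.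
Proof. reflexivity. Qed.

Lemma Im_minus (a b : C) : Im (a - b)%C = Im a - Im b.
Proof. reflexivity. Qed.

Lemma Re_Cexp z : Re (Cexp z) = exp (Re z) * cos (Im z).
Proof. unfold Cexp; simpl; ring. Qed.

Lemma Im_Cexp z : Im (Cexp z) = exp (Re z) * sin (Im z).
Proof. unfold Cexp; simpl; ring. Qed.

Lemma C_eq (a b : C) : Re a = Re b -> Im a = Im b -> a = b.
Proof. destruct a, b; simpl; congruence. Qed.

Lemma Cexp_plus a b : Cexp (a + b)%C = (Cexp a * Cexp b)%C.
Proof.
  apply C_eq; rewrite ?re_mult, ?im_mult, !Re_Cexp, !Im_Cexp, re_plus, im_plus, exp_plus.
  - rewrite cos_plus; ring.
  - rewrite sin_plus; ring.
Qed.

Lemma Cexp_RtoC (x : R) : Cexp (RtoC x) = RtoC (exp x).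
Proof. apply C_eq; rewrite ?Re_Cexp, ?Im_Cexp; simpl; rewrite ?sin_0, ?cos_0; ring. Qed.

Lemma Cexp_0 : Cexp 0%C = 1%C.
Proof. rewrite Cexp_RtoC, exp_0; reflexivity. Qed.

Lemma Cexp_neq_0 z : Cexp z <> 0%C.
Proof.
  intros H. assert (E : (Cexp z * Cexp (- z) = 1)%C).
  { rewrite <- Cexp_plus. replace (z + - z)%C with (RtoC 0) by ring. apply Cexp_0. }
  rewrite H in E. apply C1_nz. rewrite <- E. ring.
Qed.

Lemma Cmod_Cexp z : Cmod (Cexp z) = exp (Re z).
Proof.
  apply Rsqr_inj; [apply Cmod_ge_0|left; apply exp_pos|].
  unfold Rsqr. rewrite Cmod_sqr, Re_Cexp, Im_Cexp.
  generalize (sin2_cos2 (Im z)); unfold Rsqr; nra.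
Qed.

Lemma Cexp_quad (h : C) : Cmod h <= 1 / 2 ->
  Cmod (Cexp h - 1 - h)%C <= 10 * (Cmod h * Cmod h).
Proof.
  intros Hh. pose proof (Cmod_ge_0 h) as H0.
  pose proof (re_le_Cmod h) as Ha. pose proof (im_le_Cmod h) as Hb.
  eapply Rle_trans; [apply Cmod_le_abs|].
  assert (Er : Re (Cexp h - 1 - h)%C = (exp (Re h) - 1 - Re h) + exp (Re h) * (cos (Im h) - 1)).
  { unfold Cminus. rewrite !re_plus, Re_Cexp, !re_opp, re_RtoC. ring. }
  assert (Ei : Im (Cexp h - 1 - h)%C = (exp (Re h) - 1) * sin (Im h) + (sin (Im h) - Im h)).
  { unfold Cminus. rewrite !im_plus, Im_Cexp, !im_opp, im_RtoC. ring. }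
  rewrite Er, Ei. clear Er Ei.
  set (a := Re h) in *. set (b := Im h) in *. set (r := Cmod h) in *.
  apply Rabs_le_between in Ha, Hb.
  assert (L1 : 0 <= exp a - 1 - a) by (generalize (exp_ineq1_le a); lra).
  assert (L2 : exp a * (1 - a) <= 1).
  { generalize (exp_ineq1_le (- a)) (exp_pos a). intros A B.
    assert (exp a * exp (- a) = 1) by (rewrite <- exp_plus, Rplus_opp_r; apply exp_0). nra. }
  assert (L3 : exp a <= 2) by nra.
  assert (L4 : exp a - 1 - a <= 2 * (r * r)) by nra.
  assert (L5 : - (r * r / 2) <= cos b - 1 <= 0).
  { generalize (COS_bound b) (cos_ge_2 b). nra. }
  assert (L6 : Rabs (sin b) <= r /\ Rabs (sin b - b) <= r * r).
  { destruct (Rle_dec 0 b) as [P|P].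
    - generalize (sin_le_id b P) (sin_ge_3 b P). intros.
      assert (b ^ 3 / 6 <= r * r) by (simpl; nra).
      split; apply Rabs_le; [|nra]. split; [|lra].
      assert (b^3 <= b) by (simpl; nra). lra.
    - generalize (sin_le_id (- b) ltac:(lra)) (sin_ge_3 (- b) ltac:(lra)).
      rewrite sin_neg. intros.
      assert ((- b) ^ 3 / 6 <= r * r) by (simpl; nra).
      split; apply Rabs_le; [|nra]. split; [lra|].
      assert ((-b)^3 <= -b) by (simpl; nra). lra. }
  destruct L6 as [L6 L7].
  assert (L8 : Rabs (exp a - 1) <= 2 * r) by (apply Rabs_le; nra).
  assert (A1 : Rabs (exp a - 1 - a + exp a * (cos b - 1)) <= 3 * (r * r)).
  { apply Rabs_le. pose proof (exp_pos a). nra. }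
  assert (A2 : Rabs ((exp a - 1) * sin b + (sin b - b)) <= 3 * (r * r)).
  { eapply Rle_trans; [apply Rabs_triang|]. rewrite Rabs_mult.
    generalize (Rabs_pos (exp a - 1)) (Rabs_pos (sin b)). nra. }
  nra.
Qed.

Lemma cderiv_Cexp (p : C) : cderiv Cexp p (Cexp p).
Proof.
  apply cderiv_iff. intros eps He.
  set (m := Cmod (Cexp p)).
  assert (Hm : 0 < m) by (apply Cmod_gt_0, Cexp_neq_0).
  exists (Rmin (1 / 2) (eps / (10 * m))). split.
  { apply Rmin_pos; [lra|]. apply Rdiv_lt_0_compat; lra. }
  intros z Hz. apply Rmin_Rgt_l in Hz as [Hz1 Hz2].
  replace (Cexp z - Cexp p - (z - p) * Cexp p)%C with (Cexp p * (Cexp (z - p) - 1 - (z - p)))%C.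
  2:{ replace z with (p + (z - p))%C at 3 by ring. rewrite Cexp_plus. ring. }
  rewrite Cmod_mult. fold m.
  pose proof (Cexp_quad (z - p)%C ltac:(lra)) as Hq.
  set (r := Cmod (z - p)%C) in *. assert (0 <= r) by apply Cmod_ge_0.
  apply Rle_trans with (m * (10 * (r * r))); [apply Rmult_le_compat_l; lra|].
  assert (Hr : r * (10 * m) <= eps).
  { apply Rle_trans with (eps / (10 * m) * (10 * m)); [|right; field; lra].
    apply Rmult_le_compat_r; lra. }
  nra.
Qed.

(* [w (e^w - 1)^{-1}] has modulus at least 1 on the left half-plane; this is what makes
   [z e^z] injective on the disk. *)
Lemma Cmod_Cexp_minus_1 w : Re w <= 0 -> Cmod (Cexp w - 1)%C <= Cmod w.
Proof.
  intros Hw. apply Cmod_le_sqr; [apply Cmod_ge_0|]. rewrite Cmod_sqr.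
  unfold Cminus. rewrite re_plus, im_plus, Re_Cexp, Im_Cexp, re_opp, im_opp, re_RtoC, im_RtoC.
  set (a := Re w) in *. set (b := Im w).
  assert (E : exp a <= 1) by (rewrite <- exp_0; destruct Hw as [Hw| ->]; [left; now apply exp_increasing|lra]).
  pose proof (exp_ineq1_le a). pose proof (exp_pos a). pose proof (cos_ge_2 b).
  pose proof (COS_bound b).
  assert ((exp a * cos b + - (1)) * (exp a * cos b + - (1)) + (exp a * sin b + - 0) * (exp a * sin b + - 0)
    = (exp a - 1) * (exp a - 1) + 2 * exp a * (1 - cos b)) as ->.
  { generalize (sin2_cos2 b); unfold Rsqr; nra. }
  nra.
Qed.

Definition zexp (z : C) : C := (z * Cexp z)%C.

Lemma zexp_inj_aux v1 v2 : Cmod v2 < 1 -> zexp v1 = zexp v2 -> Re (v2 - v1)%C <= 0 -> v1 = v2.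
Proof.
  intros H2 E Hw. unfold zexp in E. set (w := (v2 - v1)%C) in *.
  assert (E1 : v1 = (v2 * Cexp w)%C).
  { transitivity (v1 * Cexp v1 * Cexp (- v1))%C.
    - rewrite <- Cmult_assoc, <- Cexp_plus. replace (v1 + - v1)%C with (RtoC 0) by ring.
      rewrite Cexp_0; ring.
    - rewrite E, <- Cmult_assoc, <- Cexp_plus. reflexivity. }
  assert (E2 : (w = - (v2 * (Cexp w - 1)))%C).
  { unfold w at 1. rewrite E1 at 1. ring. }
  destruct (Ceq_dec w 0%C) as [H0|H0].
  - replace v2 with (w + v1)%C by (unfold w; ring). rewrite H0; ring.
  - exfalso. apply Cmod_gt_0 in H0. pose proof (Cmod_Cexp_minus_1 w Hw) as Hle.
    assert (E3 : Cmod w = Cmod v2 * Cmod (Cexp w - 1)%C).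
    { rewrite E2 at 1. now rewrite Cmod_opp, Cmod_mult. }
    generalize (Cmod_ge_0 (Cexp w - 1)%C) (Cmod_ge_0 v2). nra.
Qed.

Lemma zexp_inj v1 v2 : Cmod v1 < 1 -> Cmod v2 < 1 -> zexp v1 = zexp v2 -> v1 = v2.
Proof.
  intros H1 H2 E. destruct (Rle_dec (Re (v2 - v1)%C) 0) as [H|H].
  - now apply zexp_inj_aux.
  - symmetry. apply zexp_inj_aux; auto.
    unfold Cminus in *; rewrite re_plus, re_opp in *; lra.
Qed.

Lemma re_zexp z : Re (zexp z) = exp (Re z) * (Re z * cos (Im z) - Im z * sin (Im z)).
Proof. unfold zexp. rewrite re_mult, Re_Cexp, Im_Cexp; ring. Qed.

Lemma im_zexp z : Im (zexp z) = exp (Re z) * (Re z * sin (Im z) + Im z * cos (Im z)).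
Proof. unfold zexp. rewrite im_mult, Re_Cexp, Im_Cexp; ring. Qed.

Lemma sin_sqr_le y : sin y * sin y <= y * y.
Proof.
  generalize (cos_ge_2 (2 * (y / 1))). replace (2 * (y / 1)) with (2 * y) by field.
  rewrite cos_2a_sin. nra.
Qed.

Lemma zexp_neq_cusp v : Cmod v < 1 -> zexp v <> RtoC (- / exp 1).
Proof.
  intros Hv E. pose proof (Cmod_sqr v) as Hs. pose proof (Cmod_ge_0 v) as Hp.
  pose proof (f_equal Re E) as ER. pose proof (f_equal Im E) as EI.
  rewrite re_zexp, re_RtoC in ER. rewrite im_zexp, im_RtoC in EI.
  set (a := Re v) in *. set (b := Im v) in *.
  pose proof (exp_pos a) as Hea.
  assert (I : a * sin b + b * cos b = 0) by (apply Rmult_integral in EI; lra).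
  assert (Hab : a * a + b * b < 1) by (rewrite <- Hs; nra).
  destruct (Req_dec b 0) as [Hb|Hb].
  - rewrite Hb, sin_0, cos_0 in ER.
    pose proof (exp_ineq1 (- (a + 1))) as L.
    assert (Ha : -1 < a) by nra.
    specialize (L ltac:(lra)).
    assert (X : exp (- (a + 1)) = - a).
    { rewrite Ropp_plus_distr, exp_plus, !exp_Ropp.
      apply Rmult_eq_reg_l with (exp a); [|lra].
      rewrite <- Rmult_assoc, Rinv_r by lra. lra. }
    lra.
  - generalize (sin2_cos2 b) (sin_sqr_le b); unfold Rsqr; intros T1 T2.
    assert (Hsin : sin b <> 0).
    { intros S. rewrite S in *. assert (b * cos b = 0) by lra.
      apply Rmult_integral in H as [?|?]; [lra|]. rewrite H in T1. lra. }
    assert (K : (a * a + b * b) * (sin b * sin b) = b * b).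
    { replace ((a * a + b * b) * (sin b * sin b))
        with ((a * sin b) * (a * sin b) + (b * sin b) * (b * sin b)) by ring.
      replace (a * sin b) with (- (b * cos b)) by lra.
      replace (b * b) with (b * b * 1) at 1 by ring. rewrite <- T1. ring. }
    assert (HS : 0 < sin b * sin b) by nra.
    assert (HN : a * a + b * b < 1) by (rewrite <- Hs; nra).
    generalize (Rmult_lt_compat_r _ _ _ HS HN). lra.
Qed.

(* Equality holds at the cusp [zexp (-1) = -1/e]. *)
Lemma zexp_circle zeta : Cmod zeta = 1 -> 1 + / exp 1 <= Cmod (zexp zeta - 1)%C.
Proof.
  intros H1. pose proof (Cmod_sqr zeta) as Hs. rewrite H1 in Hs.
  pose proof exp_1_bounds as He.
  pose proof inv_exp_1_bounds as Hi.
  set (c := / exp 1) in *.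
  assert (G : 1 + (c * c + 2 * c) <= Cmod (zexp zeta - 1)%C * Cmod (zexp zeta - 1)%C).
  2:{ generalize (Cmod_ge_0 (zexp zeta - 1)%C); nra. }
  rewrite Cmod_sqr. unfold Cminus. rewrite re_plus, im_plus, re_opp, im_opp, re_RtoC, im_RtoC.
  rewrite re_zexp, im_zexp.
  set (x := Re zeta) in *. set (y := Im zeta) in *.
  pose proof (exp_pos x) as Hx.
  match goal with |- _ <= ?r => replace r with
    (1 + (exp x * exp x - 2 * exp x * (x * cos y - y * sin y))) end.
  2:{ generalize (sin2_cos2 y); unfold Rsqr; intros T.
      replace (exp x * exp x) with (exp x * exp x * ((x * x + y * y) * (sin y * sin y + cos y * cos y)))
        by (rewrite T, <- Hs; ring). ring. }
  apply Rplus_le_compat_l.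
  assert (Hy1 : -1 <= y <= 1) by nra. assert (Hx1 : -1 <= x <= 1) by nra.
  assert (Hsin : y * y - y * y * (y * y) / 6 <= y * sin y).
  { destruct (Rle_dec 0 y) as [P|P].
    - generalize (sin_ge_3 y P); simpl; nra.
    - generalize (sin_ge_3 (- y) ltac:(lra)); rewrite sin_neg; simpl; nra. }
  pose proof (cos_ge_2 y) as Hcos. pose proof (COS_bound y) as Hcb.
  destruct (Rle_dec 0 x) as [P|P].
  - pose proof (exp_ge_2 x P) as E2.
    assert (T : x * cos y - y * sin y <= x) by nra.
    assert (T' : exp x * (1 - x + x ^ 2 / 2) <= exp x * exp x - 2 * exp x * (x * cos y - y * sin y)).
    { replace (exp x * exp x - 2 * exp x * (x * cos y - y * sin y))
        with (exp x * (exp x - 2 * (x * cos y - y * sin y))) by ring.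
      apply Rmult_le_compat_l; lra. }
    assert (T'' : (1 + x) * (1 - x + x ^ 2 / 2) <= exp x * (1 - x + x ^ 2 / 2)).
    { apply Rmult_le_compat_r; [simpl; nra|]. simpl in E2; nra. }
    assert (Q1 : x * (1 - x) <= 1 / 4) by (generalize (Rle_0_sqr (x - 1 / 2)); unfold Rsqr; lra).
    assert (Q2 : x * (x * (1 - x)) <= 1 * (1 / 4)) by (apply Rmult_le_compat; nra).
    assert (Q3 : c * c <= 0.368 * 0.368) by (apply Rmult_le_compat; lra).
    simpl in *; lra.
  - set (s := - x). assert (Hs0 : 0 <= s <= 1) by (unfold s; lra).
    assert (Ey : y * y = 1 - s * s) by (unfold s; lra).
    assert (T : s / 2 + s ^ 3 / 2 + (1 - s * s) * (5 + s * s) / 6 <= s * cos y + y * sin y).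
    { assert (s * (1 - y ^ 2 / 2) <= s * cos y) by (apply Rmult_le_compat_l; lra).
      rewrite Ey in Hsin. simpl in *. rewrite Rmult_1_r, Ey in H. lra. }
    set (E := exp (1 - s)).
    assert (HE : 2 - s <= E) by (generalize (exp_ineq1_le (1 - s)); unfold E; lra).
    assert (Ex : exp x = E * c).
    { unfold E, c. rewrite <- exp_Ropp, <- exp_plus. f_equal. unfold s; lra. }
    rewrite Ex.
    set (T0 := s * cos y + y * sin y) in *.
    replace (x * cos y - y * sin y) with (- T0) by (unfold T0, s; ring).
    assert (Poly : 1 <= (2 - s) * (s / 2 + s ^ 3 / 2 + (1 - s * s) * (5 + s * s) / 6)).
    { enough (0 <= (1 - s) * (4 + 5 * s - 6 * s ^ 2 + 4 * s ^ 3 - s ^ 4)) by (simpl in *; lra).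
      apply Rmult_le_pos; [lra|]. simpl.
      assert (0 <= s * s <= 1) by nra. nra. }
    assert (HT : 1 <= E * T0).
    { apply Rle_trans with (1 := Poly). apply Rmult_le_compat; try lra.
      simpl. nra. }
    assert (HE2 : 1 * (c * c) <= (E * E) * (c * c)) by (apply Rmult_le_compat_r; nra).
    assert (HT2 : 1 * (2 * c) <= (E * T0) * (2 * c)) by (apply Rmult_le_compat_r; lra).
    lra.
Qed.

(** * Compactness and the inverse of [z e^z] *)

Lemma nested_halves (x : nat -> R) (L : R) : 0 <= L ->
  (forall n, x n <= x (S n) <= x n + L / 2 ^ S n) ->
  exists p, forall n, x n <= p <= x n + L / 2 ^ n.
Proof.
  intros HL Hs.
  assert (Hpow : forall n, 0 < 2 ^ n) by (intros; apply pow_lt; lra).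
  assert (Hup : forall n k, x (n + k)%nat + L / 2 ^ (n + k) <= x n + L / 2 ^ n).
  { intros n k; induction k as [|k IH]; [rewrite Nat.add_0_r; lra|].
    rewrite Nat.add_succ_r. destruct (Hs (n + k)%nat) as [_ H].
    replace (L / 2 ^ (n + k)) with (L / 2 ^ S (n + k) + L / 2 ^ S (n + k)) in IH; [lra|].
    simpl. field. specialize (Hpow (n + k)%nat); lra. }
  assert (Hmono : forall n k, x n <= x (n + k)%nat).
  { intros n k; induction k as [|k IH]; [rewrite Nat.add_0_r; lra|].
    rewrite Nat.add_succ_r. destruct (Hs (n + k)%nat); lra. }
  assert (Hq : forall n, 0 <= L / 2 ^ n).
  { intros n. apply Rmult_le_pos; [lra|]. left. now apply Rinv_0_lt_compat. }
  assert (Hub : forall n m, x m <= x n + L / 2 ^ n).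
  { intros n m. destruct (Nat.le_ge_cases n m) as [H|H].
    - replace m with (n + (m - n))%nat by lia.
      generalize (Hup n (m - n)%nat) (Hq (n + (m - n))%nat); lra.
    - generalize (Hmono m (n - m)%nat) (Hq n). replace (m + (n - m))%nat with n by lia. lra. }
  destruct (completeness (fun y => exists n, y = x n)) as [p [Hp1 Hp2]].
  - exists (x 0%nat + L / 2 ^ 0). intros y [n ->]. apply Hub.
  - exists (x 0%nat), 0%nat; reflexivity.
  - exists p. intros n. split.
    + apply Hp1; now exists n.
    + apply Hp2. intros y [m ->]. apply Hub.
Qed.

(* [P x y h k] is about the rectangle [x, x + h] x [y, y + k]. *)
Lemma rectangle_bisection (a b L M : R) (P : R -> R -> R -> R -> Prop) :
  0 <= L -> 0 <= M ->
  (forall x y h k, 0 <= h -> 0 <= k -> a <= x -> x + h <= a + L -> b <= y -> y + k <= b + M ->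
     P x y (h / 2) (k / 2) -> P (x + h / 2) y (h / 2) (k / 2) ->
     P x (y + k / 2) (h / 2) (k / 2) -> P (x + h / 2) (y + k / 2) (h / 2) (k / 2) ->
     P x y h k) ->
  (forall p q, a <= p <= a + L -> b <= q <= b + M ->
     exists d, 0 < d /\ forall x y h k, 0 <= h < d -> 0 <= k < d ->
       a <= x -> x + h <= a + L -> b <= y -> y + k <= b + M ->
       x <= p <= x + h -> y <= q <= y + k -> P x y h k) ->
  P a b L M.
Proof.
  intros HL HM Hsplit Hloc. apply NNPP; intros Hbad.
  assert (Hpow : forall n, 0 < 2 ^ n) by (intros; apply pow_lt; lra).
  pose (Bad := fun n (p : R * R) => a <= fst p /\ fst p + L / 2 ^ n <= a + L /\
     b <= snd p /\ snd p + M / 2 ^ n <= b + M /\ ~ P (fst p) (snd p) (L / 2 ^ n) (M / 2 ^ n)).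
  assert (Hstep : forall n (p : {p | Bad n p}), exists p' : {p | Bad (S n) p},
     fst (proj1_sig p) <= fst (proj1_sig p') <= fst (proj1_sig p) + L / 2 ^ S n /\
     snd (proj1_sig p) <= snd (proj1_sig p') <= snd (proj1_sig p) + M / 2 ^ S n).
  { intros n [[x y] [H1 [H2 [H3 [H4 H5]]]]]. simpl in H1, H2, H3, H4, H5. cbn [proj1_sig fst snd].
    assert (EL : L / 2 ^ S n = (L / 2 ^ n) / 2) by (simpl; field; specialize (Hpow n); lra).
    assert (EM : M / 2 ^ S n = (M / 2 ^ n) / 2) by (simpl; field; specialize (Hpow n); lra).
    assert (HL' : 0 <= L / 2 ^ n) by (apply Rmult_le_pos; [lra|left; now apply Rinv_0_lt_compat]).
    assert (HM' : 0 <= M / 2 ^ n) by (apply Rmult_le_pos; [lra|left; now apply Rinv_0_lt_compat]).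
    assert (Hex : exists x' y', (x' = x \/ x' = x + L / 2 ^ S n) /\ (y' = y \/ y' = y + M / 2 ^ S n) /\
       ~ P x' y' (L / 2 ^ S n) (M / 2 ^ S n)).
    { apply NNPP; intros Hno. apply H5. rewrite EL, EM in Hno. apply Hsplit; auto;
        apply NNPP; intros Hc; apply Hno; do 2 eexists; (split; [|split; [|exact Hc]]); auto. }
    destruct Hex as [x' [y' [Hx' [Hy' Hc]]]].
    assert (Hb : Bad (S n) (x', y')).
    { unfold Bad; cbn [fst snd]. rewrite EL, EM in *. repeat split; auto; destruct Hx', Hy'; lra. }
    exists (exist _ _ Hb). cbn [proj1_sig fst snd]. rewrite EL, EM in *. destruct Hx', Hy'; lra. }
  assert (H0 : Bad 0%nat (a, b)).
  { unfold Bad; simpl. rewrite !Rdiv_1_r. repeat split; auto; lra. }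
  pose (next := fun n p => proj1_sig (constructive_indefinite_description _ (Hstep n p))).
  pose (s := fix s n : {p | Bad n p} := match n with O => exist _ _ H0 | S n => next n (s n) end).
  pose (X := fun n => fst (proj1_sig (s n))). pose (Y := fun n => snd (proj1_sig (s n))).
  assert (HXY : forall n, X n <= X (S n) <= X n + L / 2 ^ S n /\ Y n <= Y (S n) <= Y n + M / 2 ^ S n).
  { intros n. unfold X, Y. simpl s. unfold next.
    destruct (constructive_indefinite_description _ (Hstep n (s n))) as [p' Hp']. exact Hp'. }
  destruct (nested_halves X L HL) as [p Hp]; [intros n; apply HXY|].
  destruct (nested_halves Y M HM) as [q Hq]; [intros n; apply HXY|].
  destruct (Hloc p q) as [d [Hd Hd']].
  - generalize (Hp 0%nat). unfold X; simpl; lra.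
  - generalize (Hq 0%nat). unfold Y; simpl; lra.
  - destruct (pow_lt_1_zero (/ 2)) with (y := d / (L + M + 1)) as [N HN].
    { rewrite Rabs_pos_eq; lra. }
    { apply Rdiv_lt_0_compat; lra. }
    specialize (HN N (Nat.le_refl N)).
    rewrite pow_inv, Rabs_pos_eq in HN by (left; apply Rinv_0_lt_compat; auto).
    assert (Hi : 0 < / 2 ^ N) by (now apply Rinv_0_lt_compat).
    assert (HN' : (L + M + 1) * / 2 ^ N < d).
    { apply Rmult_lt_compat_l with (r := L + M + 1) in HN; [|lra].
      replace ((L + M + 1) * (d / (L + M + 1))) with d in HN by (field; lra). lra. }
    destruct (s N) as [[x y] HB] eqn:Es.
    specialize (Hp N). specialize (Hq N). unfold X, Y in Hp, Hq. rewrite Es in Hp, Hq.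
    cbn [proj1_sig fst snd] in Hp, Hq.
    destruct HB as [B1 [B2 [B3 [B4 B5]]]]. cbn [fst snd] in *. apply B5.
    unfold Rdiv in *. apply Hd'; auto; split; nra.
Qed.

Lemma uniform_lower_bound (T : R -> Prop) (K : C -> Prop) (G : C -> R) (r : R) :
  (forall m m', T m -> T m' -> T (Rmin m m')) ->
  (forall z, K z -> Cmod z <= r) ->
  (forall p, exists d m, 0 < d /\ T m /\ forall z, K z -> Cmod (z - p)%C < d -> m <= G z) ->
  exists m, T m /\ forall z, K z -> m <= G z.
Proof.
  intros HT Hr Hloc.
  destruct (Rlt_dec r 0) as [Hneg|Hpos].
  { destruct (Hloc 0%C) as [_ [m [_ [Hm _]]]]. exists m; split; auto.
    intros z Hz. specialize (Hr z Hz). generalize (Cmod_ge_0 z); lra. }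
  pose (P := fun x y h k => exists m, T m /\ forall z, K z ->
      x <= Re z <= x + h -> y <= Im z <= y + k -> m <= G z).
  assert (H : P (- r) (- r) (2 * r) (2 * r)).
  { apply (rectangle_bisection (- r) (- r) (2 * r) (2 * r) P); try lra.
    - intros x y h k _ _ _ _ _ _ [m1 [T1 H1]] [m2 [T2 H2]] [m3 [T3 H3]] [m4 [T4 H4]].
      exists (Rmin (Rmin m1 m2) (Rmin m3 m4)); split; [auto|]. intros z Hz Hx Hy.
      pose proof (Rmin_l (Rmin m1 m2) (Rmin m3 m4)). pose proof (Rmin_r (Rmin m1 m2) (Rmin m3 m4)).
      pose proof (Rmin_l m1 m2). pose proof (Rmin_r m1 m2).
      pose proof (Rmin_l m3 m4). pose proof (Rmin_r m3 m4).
      destruct (Rle_dec (Re z) (x + h / 2)), (Rle_dec (Im z) (y + k / 2)).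
      + specialize (H1 z Hz); lra.
      + specialize (H3 z Hz); lra.
      + specialize (H2 z Hz); lra.
      + specialize (H4 z Hz); lra.
    - intros p q _ _. destruct (Hloc (p, q)) as [d [m [Hd [Hm H]]]].
      exists (d / 2); split; [lra|]. intros x y h k Hh Hk _ _ _ _ Hp Hq.
      exists m; split; auto. intros z Hz Hx Hy. apply H; auto.
      eapply Rle_lt_trans; [apply Cmod_le_abs|].
      unfold Cminus. rewrite re_plus, im_plus, re_opp, im_opp. simpl (Re (p, q)). simpl (Im (p, q)).
      assert (Rabs (Re z + - p) <= h) by (apply Rabs_le; lra).
      assert (Rabs (Im z + - q) <= k) by (apply Rabs_le; lra). lra. }
  destruct H as [m [Hm H]]. exists m; split; auto. intros z Hz. specialize (Hr z Hz).
  generalize (re_le_Cmod z) (im_le_Cmod z). intros A B.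
  apply Rabs_le_between in A, B. apply H; auto; lra.
Qed.

Lemma disk_attains_min (r : R) (F : C -> R) : 0 <= r ->
  (forall p, Cmod p <= r -> forall eps, 0 < eps -> exists d, 0 < d /\
     forall z, Cmod z <= r -> Cmod (z - p)%C < d -> F p - eps < F z) ->
  exists p, Cmod p <= r /\ forall z, Cmod z <= r -> F p <= F z.
Proof.
  intros Hr Hlsc.
  assert (Hout : forall p, r < Cmod p -> forall z, Cmod z <= r -> Cmod (z - p)%C < Cmod p - r -> False).
  { intros p Hp z Hz Hd. assert (Cmod p <= Cmod z + Cmod (z - p)%C); [|lra].
    replace p with (z + - (z - p))%C at 1 by ring.
    eapply Rle_trans; [apply Cmod_triangle|]. rewrite Cmod_opp. lra. }
  destruct (uniform_lower_bound (fun _ => True) (fun z => Cmod z <= r) F r) as [m [_ Hm]]; auto.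
  { intros p. destruct (Rle_dec (Cmod p) r) as [Hp|Hp].
    - destruct (Hlsc p Hp 1 ltac:(lra)) as [d [Hd H]]. exists d, (F p - 1).
      repeat split; auto. intros z Hz Hz'. left; auto.
    - exists (Cmod p - r), 0. repeat split; [lra|]. intros z Hz Hz'. exfalso. eapply Hout; eauto; lra. }
  destruct (completeness (fun y => exists z, Cmod z <= r /\ y = - F z)) as [s [Hs1 Hs2]].
  { exists (- m). intros y [z [Hz ->]]. specialize (Hm z Hz); lra. }
  { exists (- F 0%C), 0%C. rewrite Cmod_0; auto. }
  apply NNPP; intros Hno.
  assert (Hgt : forall z, Cmod z <= r -> - s < F z).
  { intros z Hz. apply Rnot_le_lt; intros Hle. apply Hno. exists z; split; auto.
    intros z' Hz'. enough (- F z' <= s) by lra. apply Hs1; eauto. }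
  destruct (uniform_lower_bound (fun m => 0 < m) (fun z => Cmod z <= r) (fun z => F z + s) r)
    as [m' [Hm'0 Hm']]; auto.
  { intros; now apply Rmin_pos. }
  { intros p. destruct (Rle_dec (Cmod p) r) as [Hp|Hp].
    - specialize (Hgt p Hp). destruct (Hlsc p Hp ((F p + s) / 2) ltac:(lra)) as [d [Hd H]].
      exists d, ((F p + s) / 2). repeat split; [auto|lra|]. intros z Hz Hz'. specialize (H z Hz Hz'). lra.
    - exists (Cmod p - r), 1. repeat split; [lra|lra|]. intros z Hz Hz'. exfalso. eapply Hout; eauto; lra. }
  assert (s <= s - m'); [|lra]. apply Hs2. intros y [z [Hz ->]]. specialize (Hm' z Hz). lra.
Qed.

Lemma modulus_decreases (f : C -> C) (p l : C) (d : R) : cderiv f p l -> l <> 0%C -> f p <> 0%C ->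
  0 < d -> exists z, Cmod (z - p)%C < d /\ Cmod (f z) < Cmod (f p).
Proof.
  intros Hf Hl Hp Hd. destruct (cderiv_slope _ _ _ Hf) as [q [Hq [Eq E]]].
  pose proof (proj1 (Cmod_gt_0 _) Hl) as Hl'. pose proof (proj1 (Cmod_gt_0 _) Hp) as Hp'.
  destruct (Hq (Cmod l / 2) ltac:(lra)) as [d' [Hd' H]]. rewrite Eq in H.
  set (D := Rmin d d'). assert (HD : 0 < D) by (now apply Rmin_pos).
  set (t := Rmin 1 (D * Cmod l / Cmod (f p) / 2)).
  assert (Ht0 : 0 < t).
  { apply Rmin_pos; [lra|]. apply Rdiv_lt_0_compat; [|lra].
    apply Rdiv_lt_0_compat; auto. now apply Rmult_lt_0_compat. }
  assert (Ht1 : t <= 1) by apply Rmin_l.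
  assert (Ht2 : t * Cmod (f p) <= D * Cmod l / 2).
  { replace (D * Cmod l / 2) with (D * Cmod l / Cmod (f p) / 2 * Cmod (f p)) by (field; lra).
    apply Rmult_le_compat_r; [lra|apply Rmin_r]. }
  set (z := (p - RtoC t * f p / l)%C).
  assert (Ez : (z - p = - (RtoC t * f p * / l))%C) by (unfold z, Cdiv; ring).
  assert (Hz : Cmod (z - p)%C < D).
  { rewrite Ez, Cmod_opp, !Cmod_mult, Cmod_inv, Cmod_R, Rabs_pos_eq by (auto; lra).
    apply Rmult_lt_reg_r with (Cmod l); [lra|]. rewrite Rmult_assoc, Rinv_l by lra. nra. }
  exists z; split.
  - eapply Rlt_le_trans; [exact Hz|apply Rmin_l].
  - specialize (H z). rewrite (E z), Ez.
    replace (f p + - (RtoC t * f p * / l) * q z)%C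
      with (f p * (RtoC (1 - t) - RtoC t * ((q z - l) / l)))%C.
    2:{ rewrite RtoC_minus. field; auto. }
    rewrite Cmod_mult. rewrite <- (Rmult_1_r (Cmod (f p))) at 2.
    apply Rmult_lt_compat_l; auto.
    eapply Rle_lt_trans; [apply Cmod_triangle|].
    rewrite Cmod_opp, Cmod_R, Rabs_pos_eq by lra.
    unfold Cdiv. rewrite !Cmod_mult, Cmod_R, Cmod_inv, Rabs_pos_eq by (auto; lra).
    assert (Hq' : Cmod (q z - l)%C * / Cmod l < / 2).
    { apply Rmult_lt_reg_r with (Cmod l); [lra|]. rewrite Rmult_assoc, Rinv_l by lra.
      rewrite Rmult_1_r. eapply Rlt_le_trans; [apply H|lra].
      eapply Rlt_le_trans; [exact Hz|apply Rmin_r]. }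
    nra.
Qed.

Lemma cderiv_zexp (p : C) : cderiv zexp p ((1 + p) * Cexp p)%C.
Proof.
  eapply cderiv_val; [|apply cderiv_mult; [apply cderiv_id|apply cderiv_Cexp]].
  cbv beta; ring.
Qed.

Lemma zexp_deriv_neq_0 (p : C) : Cmod p < 1 -> ((1 + p) * Cexp p)%C <> 0%C.
Proof.
  intros Hp. apply Cmult_neq_0; [|apply Cexp_neq_0]. intros H.
  assert (E : p = (- (1))%C) by (transitivity ((1 + p) - 1)%C; [ring|rewrite H; ring]).
  rewrite E, Cmod_opp, Cmod_1 in Hp. lra.
Qed.

Lemma ccont_dist (f : C -> C) (c p : C) : ccont f p -> forall eps, 0 < eps ->
  exists d, 0 < d /\ forall z, Cmod (z - p)%C < d -> Cmod (f p - c)%C - eps < Cmod (f z - c)%C.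
Proof.
  intros Hf eps He. destruct (Hf eps He) as [d [Hd H]]. exists d; split; auto.
  intros z Hz. specialize (H z Hz).
  assert (Cmod (f p - c)%C <= Cmod (f z - c)%C + Cmod (f z - f p)%C); [|lra].
  replace (f p - c)%C with ((f z - c) + - (f z - f p))%C by ring.
  eapply Rle_trans; [apply Cmod_triangle|]. rewrite Cmod_opp; lra.
Qed.

Lemma zexp_onto_step (u u' v' : C) :
  Cmod v' < 1 -> zexp v' = u' -> Cmod (u - u')%C < 1 + / exp 1 - Cmod (u - 1)%C ->
  exists v, Cmod v < 1 /\ zexp v = u.
Proof.
  intros Hv' <- Hu.
  destruct (disk_attains_min 1 (fun z => Cmod (zexp z - u)%C)) as [p [Hp Hmin]]; [lra| |].
  { intros p _ eps He. destruct (ccont_dist zexp u p (cderiv_cont _ _ _ (cderiv_zexp p)) eps He)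
      as [d [Hd H]]. exists d; split; auto. }
  assert (Hp1 : Cmod p < 1).
  { destruct Hp as [Hp|Hp]; auto. exfalso. pose proof (zexp_circle p Hp) as Hc.
    specialize (Hmin v' ltac:(lra)). rewrite <- Cmod_opp in Hu.
    replace (- (u - zexp v'))%C with (zexp v' - u)%C in Hu by ring.
    assert (Cmod (zexp p - 1)%C <= Cmod (zexp p - u)%C + Cmod (u - 1)%C); [|lra].
    replace (zexp p - 1)%C with ((zexp p - u) + (u - 1))%C by ring. apply Cmod_triangle. }
  exists p; split; auto. apply NNPP; intros Hne.
  destruct (modulus_decreases (fun z => zexp z - u)%C p ((1 + p) * Cexp p - 0)%C (1 - Cmod p))
    as [z [Hz1 Hz2]].
  - apply cderiv_minus; [apply cderiv_zexp|apply cderiv_const].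
  - intros H. apply (zexp_deriv_neq_0 p Hp1). rewrite <- H. ring.
  - intros H. apply Hne. transitivity ((zexp p - u) + u)%C; [ring|rewrite H; ring].
  - lra.
  - specialize (Hmin z). assert (Cmod z <= 1); [|specialize (Hmin H); lra].
    replace z with ((z - p) + p)%C by ring.
    eapply Rle_trans; [apply Cmod_triangle|]. lra.
Qed.

Lemma Cmod_segment (u : C) (t : R) : 0 <= t <= 1 ->
  Cmod (RtoC t * u - 1)%C <= Rmax 1 (Cmod (u - 1)%C).
Proof.
  intros Ht. replace (RtoC t * u - 1)%C with (RtoC t * (u - 1) + RtoC (1 - t) * (- (1)))%C
    by (rewrite RtoC_minus; ring).
  eapply Rle_trans; [apply Cmod_triangle|]. rewrite !Cmod_mult, !Cmod_R, Cmod_opp, Cmod_1, !Rabs_pos_eq by lra.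
  pose proof (Rmax_l 1 (Cmod (u - 1)%C)). pose proof (Rmax_r 1 (Cmod (u - 1)%C)). nra.
Qed.

Lemma zexp_onto (u : C) : Cmod (u - 1)%C < 1 + / exp 1 -> exists v, Cmod v < 1 /\ zexp v = u.
Proof.
  intros Hu. pose proof inv_exp_1_bounds as He.
  set (g := 1 + / exp 1 - Rmax 1 (Cmod (u - 1)%C)).
  assert (Hg : 0 < g) by (unfold g, Rmax; destruct (Rle_dec 1 (Cmod (u - 1)%C)); lra).
  destruct (INR_unbounded (Cmod u / g)) as [n Hn].
  assert (Hn0 : 0 < INR n).
  { eapply Rle_lt_trans; [|exact Hn]. apply Rmult_le_pos; [apply Cmod_ge_0|left; now apply Rinv_0_lt_compat]. }
  assert (HI : forall k, (k <= n)%nat -> exists v, Cmod v < 1 /\ zexp v = (RtoC (INR k / INR n) * u)%C).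
  { induction k as [|k IH]; intros Hk.
    - exists 0%C. rewrite Cmod_0. split; [lra|]. unfold zexp. simpl (INR 0).
      replace (0 / INR n) with 0 by (field; lra). ring.
    - destruct IH as [v [Hv Ev]]; [lia|]. apply (zexp_onto_step _ _ v Hv Ev).
      apply le_INR in Hk. pose proof (pos_INR k). rewrite S_INR in *.
      assert (Hs : 0 <= (INR k + 1) / INR n <= 1).
      { split; [apply Rmult_le_pos; [lra|left; now apply Rinv_0_lt_compat]|].
        apply Rmult_le_reg_r with (INR n); auto. unfold Rdiv. rewrite Rmult_assoc, Rinv_l; lra. }
      pose proof (Cmod_segment u _ Hs).
      apply Rlt_le_trans with g; [|unfold g; lra].
      replace (RtoC ((INR k + 1) / INR n) * u - RtoC (INR k / INR n) * u)%C with (RtoC (/ INR n) * u)%C.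
      2:{ rewrite <- (Rplus_0_r (/ INR n)). replace (/ INR n + 0) with ((INR k + 1) / INR n - INR k / INR n) by (field; lra).
          rewrite RtoC_minus; ring. }
      rewrite Cmod_mult, Cmod_R, Rabs_pos_eq by (left; now apply Rinv_0_lt_compat).
      apply Rmult_lt_reg_l with (INR n); auto. rewrite <- Rmult_assoc, Rinv_r, Rmult_1_l by lra.
      apply Rmult_lt_compat_r with (r := g) in Hn; auto.
      replace (Cmod u / g * g) with (Cmod u) in Hn by (field; lra). lra. }
  destruct (HI n (Nat.le_refl n)) as [v [Hv Ev]]. exists v; split; auto. rewrite Ev.
  replace (INR n / INR n) with 1 by (field; lra). ring.
Qed.

Lemma zexp_analytic_inverse : exists V : C -> C, forall u, Cmod (u - 1)%C < 1 + / exp 1 ->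
  Cmod (V u) < 1 /\ zexp (V u) = u /\ exists l, cderiv V u l.
Proof.
  pose (V := fun u => epsilon (inhabits (RtoC 0)) (fun v => Cmod v < 1 /\ zexp v = u)).
  assert (HV : forall u, Cmod (u - 1)%C < 1 + / exp 1 -> Cmod (V u) < 1 /\ zexp (V u) = u).
  { intros u Hu. unfold V. apply epsilon_spec. now apply zexp_onto. }
  exists V. intros u0 Hu0. destruct (HV u0 Hu0) as [Hv0 Ev0]. split; [auto|split;[auto|]].
  exists (/ ((1 + V u0) * Cexp (V u0)))%C.
  apply cderiv_right_inverse with zexp; auto using cderiv_zexp, zexp_deriv_neq_0.
  - intros eps He.
    destruct (uniform_lower_bound (fun m => 0 < m) (fun v => Cmod v <= 1 /\ eps <= Cmod (v - V u0)%C)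
      (fun v => Cmod (zexp v - u0)%C) 1) as [m [Hm H]].
    + intros; now apply Rmin_pos.
    + tauto.
    + intros p. destruct (Rlt_dec 1 (Cmod p)) as [Hp|Hp].
      { exists (Cmod p - 1), 1. repeat split; try lra. intros z [Hz _] Hz'. exfalso.
        assert (Cmod p <= Cmod z + Cmod (z - p)%C); [|lra].
        replace p with (z + - (z - p))%C at 1 by ring.
        eapply Rle_trans; [apply Cmod_triangle|]. rewrite Cmod_opp. lra. }
      destruct (Rlt_dec (Cmod (p - V u0)%C) eps) as [Hp2|Hp2].
      { exists (eps - Cmod (p - V u0)%C), 1. repeat split; try lra. intros z [_ Hz] Hz'. exfalso.
        assert (Cmod (z - V u0)%C <= Cmod (z - p)%C + Cmod (p - V u0)%C); [|lra].
        replace (z - V u0)%C with ((z - p) + (p - V u0))%C by ring. apply Cmod_triangle. }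
      assert (Hpos : 0 < Cmod (zexp p - u0)%C).
      { destruct (Rlt_dec (Cmod p) 1) as [Hp1|Hp1].
        - apply Cmod_gt_0. intros E. apply Hp2.
          assert (p = V u0) as <-.
          { apply zexp_inj; auto. rewrite Ev0. transitivity ((zexp p - u0) + u0)%C; [ring|rewrite E; ring]. }
          unfold Cminus. rewrite Cplus_opp_r, Cmod_0. exact He.
        - pose proof (zexp_circle p ltac:(lra)) as Hc.
          assert (Cmod (zexp p - 1)%C <= Cmod (zexp p - u0)%C + Cmod (u0 - 1)%C); [|lra].
          replace (zexp p - 1)%C with ((zexp p - u0) + (u0 - 1))%C by ring. apply Cmod_triangle. }
      destruct (ccont_dist zexp u0 p (cderiv_cont _ _ _ (cderiv_zexp p)) (Cmod (zexp p - u0)%C / 2) ltac:(lra))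
        as [d [Hd Hd']].
      exists d, (Cmod (zexp p - u0)%C / 2). repeat split; [auto|lra|].
      intros z _ Hz. specialize (Hd' z Hz). lra.
    + exists (Rmin m (1 + / exp 1 - Cmod (u0 - 1)%C)). split; [apply Rmin_pos; lra|].
      intros u Hu. apply Rmin_Rgt_l in Hu as [Hu1 Hu2].
      destruct (HV u) as [Hv Ev].
      { replace (u - 1)%C with ((u - u0) + (u0 - 1))%C by ring.
        eapply Rle_lt_trans; [apply Cmod_triangle|]. lra. }
      apply Rnot_le_lt; intros Hle. specialize (H (V u) ltac:(split; lra)).
      rewrite Ev in H. lra.
  - exists (1 + / exp 1 - Cmod (u0 - 1)%C). split; [lra|]. intros u Hu. apply HV.
    replace (u - 1)%C with ((u - u0) + (u0 - 1))%C by ring.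
    eapply Rle_lt_trans; [apply Cmod_triangle|]. lra.
Qed.

(** * Goursat's theorem and the Schwarz lemma *)

(* [U + i V] has complex derivative [A + i B] at [p + i q]. *)
Definition cauchy_riemann (U V : R -> R -> R) (p q A B : R) : Prop :=
  forall eps, 0 < eps -> exists d, 0 < d /\ forall x y, Rabs (x - p) < d -> Rabs (y - q) < d ->
    Rabs (U x y - U p q - (A * (x - p) - B * (y - q))) <= eps * (Rabs (x - p) + Rabs (y - q)) /\
    Rabs (V x y - V p q - (B * (x - p) + A * (y - q))) <= eps * (Rabs (x - p) + Rabs (y - q)).

Lemma continuous_of_linear_approx (f : R -> R) (p A : R) :
  (exists d, 0 < d /\ forall x, Rabs (x - p) < d -> Rabs (f x - f p - A * (x - p)) <= Rabs (x - p)) ->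
  continuous f p.
Proof.
  intros [d [Hd H]]. apply continuity_pt_filterlim. intros eps He.
  exists (Rmin d (eps / (2 + Rabs A))). pose proof (Rabs_pos A). split.
  { apply Rmin_pos; auto. apply Rdiv_lt_0_compat; lra. }
  intros x [_ Hx]. simpl in *. unfold Rdist in *.
  apply Rmin_Rgt_l in Hx as [H1 H2]. specialize (H x H1).
  replace (f x - f p) with ((f x - f p - A * (x - p)) + A * (x - p)) by ring.
  eapply Rle_lt_trans; [apply Rabs_triang|]. rewrite Rabs_mult.
  apply Rmult_lt_compat_r with (r := 2 + Rabs A) in H2; [|lra].
  replace (eps / (2 + Rabs A) * (2 + Rabs A)) with eps in H2 by (field; lra).
  pose proof (Rabs_pos (x - p)). nra.
Qed.

Lemma cauchy_riemann_continuous (U V : R -> R -> R) (p q A B : R) : cauchy_riemann U V p q A B ->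
  continuous (fun y => U p y) q /\ continuous (fun x => V x q) p.
Proof.
  intros H. destruct (H 1 ltac:(lra)) as [d [Hd H']]. split.
  - apply continuous_of_linear_approx with (- B). exists d; split; auto. intros y Hy.
    destruct (H' p y) as [H1 _]; [rewrite Rminus_diag, Rabs_R0; auto|auto|].
    rewrite Rminus_diag, Rabs_R0 in H1.
    replace (U p y - U p q - - B * (y - q)) with (U p y - U p q - (A * 0 - B * (y - q))) by ring. lra.
  - apply continuous_of_linear_approx with B. exists d; split; auto. intros x Hx.
    destruct (H' x q) as [_ H1]; [auto|rewrite Rminus_diag, Rabs_R0; auto|].
    rewrite Rminus_diag, Rabs_R0 in H1.
    replace (V x q - V p q - B * (x - p)) with (V x q - V p q - (B * (x - p) + A * 0)) by ring. lra.
Qed.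

Lemma ex_RInt_on_segment (f : R -> R) (a b : R) : a <= b ->
  (forall x, a <= x <= b -> continuous f x) -> ex_RInt f a b.
Proof.
  intros Hab H. apply (ex_RInt_continuous (V := R_CompleteNormedModule)).
  intros x Hx. rewrite Rmin_left, Rmax_right in Hx by lra. auto.
Qed.

Lemma goursat_rectangle (U V : R -> R -> R) (a b L M : R) : 0 <= L -> 0 <= M ->
  (forall p q, a <= p <= a + L -> b <= q <= b + M -> exists A B, cauchy_riemann U V p q A B) ->
  RInt (fun x => V x b) a (a + L) - RInt (fun x => V x (b + M)) a (a + L)
  + RInt (U (a + L)) b (b + M) - RInt (U a) b (b + M) = 0.
Proof.
  intros HL HM Hcr.
  pose (J := fun x y h k => RInt (fun s => V s y) x (x + h) - RInt (fun s => V s (y + k)) x (x + h)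
    + RInt (U (x + h)) y (y + k) - RInt (U x) y (y + k)).
  change (J a b L M = 0).
  assert (HU : forall p, a <= p <= a + L -> forall y y', b <= y -> y <= y' -> y' <= b + M -> ex_RInt (U p) y y').
  { intros p Hp y y' H1 H2 H3. apply ex_RInt_on_segment; auto. intros q Hq.
    destruct (Hcr p q) as [A [B H]]; auto; [lra|]. apply (cauchy_riemann_continuous _ _ _ _ _ _ H). }
  assert (HV : forall q, b <= q <= b + M -> forall x x', a <= x -> x <= x' -> x' <= a + L ->
    ex_RInt (fun s => V s q) x x').
  { intros q Hq x x' H1 H2 H3. apply ex_RInt_on_segment; auto. intros p Hp.
    destruct (Hcr p q) as [A [B H]]; auto; [lra|]. apply (cauchy_riemann_continuous _ _ _ _ _ _ H). }
  assert (Hsmall : forall eta, 0 < eta -> Rabs (J a b L M) <= eta * ((L + M) * (L + M))).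
  { intros eta Heta.
    apply (rectangle_bisection a b L M (fun x y h k => Rabs (J x y h k) <= eta * ((h + k) * (h + k)))); auto.
    - intros x y h k Hh Hk Hx1 Hx2 Hy1 Hy2 H1 H2 H3 H4.
      assert (E : J x y h k = J x y (h / 2) (k / 2) + J (x + h / 2) y (h / 2) (k / 2)
        + J x (y + k / 2) (h / 2) (k / 2) + J (x + h / 2) (y + k / 2) (h / 2) (k / 2)).
      { unfold J. replace (x + h / 2 + h / 2) with (x + h) by field.
        replace (y + k / 2 + k / 2) with (y + k) by field.
        assert (CV : forall q, b <= q <= b + M -> RInt (fun s => V s q) x (x + h) =
          RInt (fun s => V s q) x (x + h / 2) + RInt (fun s => V s q) (x + h / 2) (x + h)).
        { intros q Hq. symmetry. apply (RInt_Chasles (V := R_CompleteNormedModule)); apply HV; lra. }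
        assert (CU : forall p, a <= p <= a + L -> RInt (U p) y (y + k) =
          RInt (U p) y (y + k / 2) + RInt (U p) (y + k / 2) (y + k)).
        { intros p Hp. symmetry. apply (RInt_Chasles (V := R_CompleteNormedModule)); apply HU; lra. }
        rewrite (CV y), (CV (y + k)), (CU x), (CU (x + h)) by lra. ring. }
      rewrite E. apply Rabs_le. apply Rabs_le_between in H1, H2, H3, H4.
      replace ((h / 2 + k / 2) * (h / 2 + k / 2)) with ((h + k) * (h + k) / 4) in * by field. lra.
    - intros p q Hp Hq. destruct (Hcr p q Hp Hq) as [A [B H]].
      destruct (H (eta / 2) ltac:(lra)) as [d [Hd Hd']]. exists d; split; auto.
      intros x y h k Hh Hk Hx1 Hx2 Hy1 Hy2 Hxp Hyq.
      assert (Hab : forall s, x <= s <= x + h -> Rabs (s - p) <= h) by (intros; apply Rabs_le; lra).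
      assert (Hbb : forall s, y <= s <= y + k -> Rabs (s - q) <= k) by (intros; apply Rabs_le; lra).
      assert (Happ : forall s t, x <= s <= x + h -> y <= t <= y + k ->
        Rabs (U s t - U p q - (A * (s - p) - B * (t - q))) <= eta / 2 * (h + k) /\
        Rabs (V s t - V p q - (B * (s - p) + A * (t - q))) <= eta / 2 * (h + k)).
      { intros s t Hs Ht. specialize (Hab s Hs). specialize (Hbb t Ht).
        destruct (Hd' s t) as [D1 D2]; try lra.
        assert (eta / 2 * (Rabs (s - p) + Rabs (t - q)) <= eta / 2 * (h + k)) by (apply Rmult_le_compat_l; lra).
        lra. }
      assert (E : J x y h k = RInt (fun s => V s y - V s (y + k) + A * k) x (x + h)
        + RInt (fun t => U (x + h) t - U x t - A * h) y (y + k)).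
      { unfold J.
        rewrite (RInt_plus (V := R_CompleteNormedModule) (fun s => V s y - V s (y + k)) (fun _ => A * k)).
        2:{ apply (ex_RInt_minus (V := R_CompleteNormedModule)); apply HV; lra. }
        2:{ apply ex_RInt_const. }
        rewrite (RInt_minus (V := R_CompleteNormedModule) (fun s => V s y)) by (apply HV; lra).
        rewrite (RInt_minus (V := R_CompleteNormedModule) (fun t => U (x + h) t - U x t) (fun _ => A * h)).
        2:{ apply (ex_RInt_minus (V := R_CompleteNormedModule)); apply HU; lra. }
        2:{ apply ex_RInt_const. }
        rewrite (RInt_minus (V := R_CompleteNormedModule) (U (x + h))) by (apply HU; lra).
        rewrite !RInt_const. unfold plus, minus, opp, scal, mult; simpl. unfold mult; simpl.
        unfold plus; simpl. ring. }
      rewrite E. eapply Rle_trans; [apply Rabs_triang|].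
      assert (B1 : Rabs (RInt (fun s => V s y - V s (y + k) + A * k) x (x + h))
        <= (x + h - x) * (eta * (h + k))).
      { apply abs_RInt_le_const; [lra| |].
        - apply (ex_RInt_plus (V := R_CompleteNormedModule) (fun s => V s y - V s (y + k)) (fun _ => A * k)).
          + apply (ex_RInt_minus (V := R_CompleteNormedModule)); apply HV; lra.
          + apply ex_RInt_const.
        - intros s Hs. destruct (Happ s y) as [_ D1]; try lra. destruct (Happ s (y + k)) as [_ D2]; try lra.
          apply Rabs_le_between in D1, D2. apply Rabs_le. lra. }
      assert (B2 : Rabs (RInt (fun t => U (x + h) t - U x t - A * h) y (y + k))
        <= (y + k - y) * (eta * (h + k))).
      { apply abs_RInt_le_const; [lra| |].
        - apply (ex_RInt_minus (V := R_CompleteNormedModule) (fun t => U (x + h) t - U x t) (fun _ => A * h)).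
          + apply (ex_RInt_minus (V := R_CompleteNormedModule)); apply HU; lra.
          + apply ex_RInt_const.
        - intros t Ht. destruct (Happ x t) as [D1 _]; try lra. destruct (Happ (x + h) t) as [D2 _]; try lra.
          apply Rabs_le_between in D1, D2. apply Rabs_le. lra. }
      lra. }
  apply NNPP; intros Hne. apply Rabs_pos_lt in Hne.
  set (X := (L + M) * (L + M)) in *. assert (HX : 0 <= X) by (unfold X; nra).
  specialize (Hsmall (Rabs (J a b L M) / (2 * (X + 1)))).
  assert (H0 : 0 < Rabs (J a b L M) / (2 * (X + 1))) by (apply Rdiv_lt_0_compat; lra).
  specialize (Hsmall H0).
  assert (E : Rabs (J a b L M) = Rabs (J a b L M) / (2 * (X + 1)) * (2 * (X + 1))) by (field; lra).
  nra.
Qed.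

Lemma cderiv_cauchy_riemann (H : C -> C) (p q : R) (l : C) : cderiv H (p, q) l ->
  cauchy_riemann (fun x y => Re (H (x, y))) (fun x y => Im (H (x, y))) p q (Re l) (Im l).
Proof.
  intros Hd eps He. rewrite cderiv_iff in Hd. destruct (Hd eps He) as [d [Hd0 Hd']].
  exists (d / 2); split; [lra|]. intros x y Hx Hy.
  assert (E : Cmod ((x, y) - (p, q))%C <= Rabs (x - p) + Rabs (y - q)) by apply Cmod_le_abs.
  specialize (Hd' (x, y) ltac:(lra)).
  set (D := (H (x, y) - H (p, q) - ((x, y) - (p, q)) * l)%C) in *.
  assert (HD : Cmod D <= eps * (Rabs (x - p) + Rabs (y - q))).
  { eapply Rle_trans; [exact Hd'|]. apply Rmult_le_compat_l; lra. }
  split.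
  - eapply Rle_trans; [|exact HD]. eapply Rle_trans; [|apply re_le_Cmod]. right. f_equal.
    unfold D, Cminus. rewrite !re_plus, !re_opp, re_mult. simpl. ring.
  - eapply Rle_trans; [|exact HD]. eapply Rle_trans; [|apply im_le_Cmod]. right. f_equal.
    unfold D, Cminus. rewrite !im_plus, !im_opp, im_mult. simpl. ring.
Qed.

(* In the coordinate [z = a + e^(s + i t)] the circle means of [K] are constant in [s], because
   the horizontal sides of the rectangle [s0, s1] x [0, 2 pi] cancel. *)
Lemma no_strict_circle_bound (K : C -> C) (a : C) (r eta : R) : 0 < r -> 0 < eta -> ccont K a ->
  (forall z, z <> a -> Cmod (z - a)%C <= r -> exists l, cderiv K z l) ->
  ~ (forall z, Cmod (z - a)%C = r -> Re (K z) <= Re (K a) - eta).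
Proof.
  intros Hr Heta Ha HK Hb.
  destruct (Ha (eta / 2) ltac:(lra)) as [d [Hd Hd']].
  pose (H := fun w => K (a + Cexp w)%C).
  pose (s1 := ln r). pose (s0 := Rmin (ln r) (ln (d / 2))).
  assert (Hmod : forall s t, Cmod (a + Cexp (s, t) - a)%C = exp s).
  { intros s t. replace (a + Cexp (s, t) - a)%C with (Cexp (s, t)) by ring. apply Cmod_Cexp. }
  assert (HH : forall p q, p <= s1 -> exists A B,
    cauchy_riemann (fun x y => Re (H (x, y))) (fun x y => Im (H (x, y))) p q A B).
  { intros p q Hp. destruct (HK (a + Cexp (p, q))%C) as [l Hl].
    - intros E. apply (Cexp_neq_0 (p, q)). transitivity ((a + Cexp (p, q)) - a)%C; [ring|rewrite E; ring].
    - rewrite Hmod. rewrite <- (exp_ln r Hr). destruct Hp as [Hp| ->]; [left; now apply exp_increasing|apply Rle_refl].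
    - do 2 eexists. apply cderiv_cauchy_riemann. apply (cderiv_comp (fun w => a + Cexp w)%C K); [|exact Hl].
      apply cderiv_plus; [apply cderiv_const|apply cderiv_Cexp]. }
  pose proof PI_RGT_0 as Hpi.
  assert (Hs : s0 <= s1) by apply Rmin_l.
  pose proof (goursat_rectangle _ _ s0 0 (s1 - s0) (2 * PI) ltac:(lra) ltac:(lra)
    (fun p q Hp _ => HH p q ltac:(lra))) as G.
  replace (s0 + (s1 - s0)) with s1 in G by ring. rewrite Rplus_0_l in G.
  assert (Eper : RInt (fun x => Im (H (x, 2 * PI))) s0 s1 = RInt (fun x => Im (H (x, 0))) s0 s1).
  { apply RInt_ext. intros x _. unfold H. do 3 f_equal. unfold Cexp; simpl.
    rewrite cos_2PI, sin_2PI, cos_0, sin_0. reflexivity. }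
  cbv beta in G. rewrite Eper in G.
  assert (Hex : forall s, s <= s1 -> ex_RInt (fun y => Re (H (s, y))) 0 (2 * PI)).
  { intros s Hs'. apply ex_RInt_on_segment; [lra|]. intros q _. destruct (HH s q Hs') as [A [B Hcr]].
    apply (cauchy_riemann_continuous _ _ _ _ _ _ Hcr). }
  assert (I1 : RInt (fun y => Re (H (s1, y))) 0 (2 * PI) <= RInt (fun _ => Re (K a) - eta) 0 (2 * PI)).
  { apply RInt_le; [lra|apply Hex; lra|apply ex_RInt_const|]. intros t _. apply Hb.
    rewrite Hmod. apply exp_ln; auto. }
  assert (I0 : RInt (fun _ => Re (K a) - eta / 2) 0 (2 * PI) <= RInt (fun y => Re (H (s0, y))) 0 (2 * PI)).
  { apply RInt_le; [lra|apply ex_RInt_const|apply Hex; lra|]. intros t _.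
    assert (Hlt : Cmod (H (s0, t) - K a)%C < eta / 2).
    { apply Hd'. rewrite Hmod. apply Rle_lt_trans with (d / 2); [|lra].
      rewrite <- (exp_ln (d / 2)) by lra. unfold s0.
      destruct (Rmin_r (ln r) (ln (d / 2))) as [Hl| ->]; [left; now apply exp_increasing|apply Rle_refl]. }
    pose proof (re_le_Cmod (H (s0, t) - K a)%C) as Hre. unfold Cminus in Hre at 1.
    rewrite re_plus, re_opp in Hre. apply Rabs_le_between in Hre. lra. }
  rewrite RInt_const in I1, I0. unfold scal in I1, I0; simpl in I1, I0. unfold mult in I1, I0; simpl in I1, I0.
  nra.
Qed.

Lemma schwarz (w : C -> C) : analytic_D w -> w (RtoC 0) = RtoC 0 -> (forall z, inD z -> inD (w z)) ->
  forall z, inD z -> Cmod (w z) <= Cmod z.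
Proof.
  unfold analytic_D, inD. intros Hw Hw0 HwD.
  destruct (Hw 0%C) as [l0 Hl0]; [rewrite Cmod_0; lra|].
  destruct (cderiv_slope w 0%C l0 Hl0) as [g [Hg0 [_ Eg]]].
  assert (Eg' : forall z, w z = (z * g z)%C).
  { intros z. rewrite (Eg z), Hw0. ring. }
  assert (Hgd : forall z : C, z <> 0%C -> Cmod z < 1 -> exists l, cderiv g z l).
  { intros z Hz Hz1. destruct (Hw z Hz1) as [l Hl]. exists ((l * z - w z * 1) / (z * z))%C.
    apply Cmod_gt_0 in Hz as Hz'.
    apply (cderiv_ext_loc (fun y => w y / y)%C g z _ (Cmod z) Hz').
    - intros y Hy. rewrite Eg'. field. intros ->.
      replace (0 - z)%C with (- z)%C in Hy by ring. rewrite Cmod_opp in Hy. lra.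
    - apply cderiv_div; auto using cderiv_id. }
  assert (Hgc : forall z : C, Cmod z < 1 -> ccont g z).
  { intros z Hz. destruct (Ceq_dec z 0%C) as [->|Hz0]; auto.
    destruct (Hgd z Hz0 Hz) as [l Hl]. now apply cderiv_cont with l. }
  assert (Hmain : forall rho z0, 0 < rho < 1 -> Cmod z0 <= rho -> Cmod (g z0) <= / rho).
  { intros rho z0 Hrho Hz0. apply Rnot_lt_le; intros Hgt.
    set (eps := (Cmod (g z0) - / rho) / 2). assert (Heps : 0 < eps) by (unfold eps; lra).
    destruct (disk_attains_min rho (fun z => - (Cmod (g z) + eps * (Cmod z * Cmod z)))) as [a [Ha Hmin]]; [lra| |].
    { intros p Hp e He. destruct (Hgc p ltac:(lra) (e / 2) ltac:(lra)) as [d [Hd Hd']].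
      exists (Rmin d (e / (4 * eps))). split; [apply Rmin_pos; auto; apply Rdiv_lt_0_compat; lra|].
      intros z Hz Hzp. apply Rmin_Rgt_l in Hzp as [H1 H2]. specialize (Hd' z H1).
      assert (T1 : Cmod (g z) <= Cmod (g p) + Cmod (g z - g p)%C).
      { replace (g z) with (g p + (g z - g p))%C at 1 by ring. apply Cmod_triangle. }
      assert (T2 : Cmod z <= Cmod p + Cmod (z - p)%C).
      { replace z with (p + (z - p))%C at 1 by ring. apply Cmod_triangle. }
      apply Rmult_lt_compat_r with (r := 4 * eps) in H2; [|lra].
      replace (e / (4 * eps) * (4 * eps)) with e in H2 by (field; lra).
      pose proof (Cmod_ge_0 z). pose proof (Cmod_ge_0 p). pose proof (Cmod_ge_0 (z - p)%C).
      assert (T3 : Cmod z * Cmod z - Cmod p * Cmod p <= 2 * Cmod (z - p)%C) by nra.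
      nra. }
    assert (Ga : / rho + 2 * eps <= Cmod (g a) + eps * (Cmod a * Cmod a)).
    { specialize (Hmin z0 Hz0). generalize (Cmod_ge_0 z0). unfold eps in *. nra. }
    pose proof (Cmod_ge_0 a) as Ha0.
    assert (Hir : 0 < / rho) by (apply Rinv_0_lt_compat; lra).
    assert (Ha1 : Cmod a < rho).
    { destruct Ha as [Ha|Ha]; auto. exfalso.
      specialize (HwD a ltac:(lra)). rewrite Eg', Cmod_mult, Ha in HwD.
      assert (Cmod (g a) < / rho).
      { apply Rmult_lt_reg_l with rho; [lra|]. rewrite Rinv_r; lra. }
      assert (eps * (Cmod a * Cmod a) <= eps * 1) by (apply Rmult_le_compat_l; nra). lra. }
    assert (Hga : 0 < Cmod (g a)).
    { assert (eps * (Cmod a * Cmod a) <= eps * 1) by (apply Rmult_le_compat_l; nra). lra. }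
    assert (Hr : exists r, 0 < r /\ Cmod a + r <= rho /\ forall z : C, z <> a -> Cmod (z - a)%C <= r -> z <> 0%C).
    { destruct (Ceq_dec a 0%C) as [->|Hane].
      - exists (rho / 2). rewrite Cmod_0. split; [lra|split; [lra|]]. auto.
      - apply Cmod_gt_0 in Hane. exists (Rmin (rho - Cmod a) (Cmod a / 2)).
        pose proof (Rmin_l (rho - Cmod a) (Cmod a / 2)). pose proof (Rmin_r (rho - Cmod a) (Cmod a / 2)).
        split; [apply Rmin_pos; lra|split; [lra|]]. intros z _ Hz ->.
        replace (0 - a)%C with (- a)%C in Hz by ring. rewrite Cmod_opp in Hz. lra. }
    destruct Hr as [r [Hr0 [Hr1 Hr2]]].
    assert (Hin : forall z, Cmod (z - a)%C <= r -> Cmod z <= rho).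
    { intros z Hz. replace z with (a + (z - a))%C by ring. eapply Rle_trans; [apply Cmod_triangle|]. lra. }
    pose (c := (Cconj (g a) / RtoC (Cmod (g a)))%C).
    assert (Hnz : RtoC (Cmod (g a)) <> 0%C) by (intros E; apply RtoC_inj in E; lra).
    assert (Hc : Cmod c = 1).
    { unfold c, Cdiv. rewrite Cmod_mult, Cmod_inv, Cmod_conj, Cmod_R, Rabs_pos_eq by (auto; lra). field; lra. }
    assert (Hca : (c * g a)%C = RtoC (Cmod (g a))).
    { transitivity ((g a * Cconj (g a)) / RtoC (Cmod (g a)))%C; [unfold c; field; auto|].
      rewrite <- Cmod2_conj. rewrite RtoC_pow. field; auto. }
    pose (K := fun z => (c * g z + RtoC (2 * eps) * Cconj a * z)%C).
    apply (no_strict_circle_bound K a r (eps * (r * r))); auto; [apply Rmult_lt_0_compat; [exact Heps|nra]| | |].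
    - apply ccont_plus; apply ccont_mult; auto using ccont_const, ccont_id. apply Hgc; lra.
    - intros z Hza Hz. destruct (Hgd z (Hr2 z Hza Hz)) as [l Hl]; [specialize (Hin z Hz); lra|].
      eexists. apply cderiv_plus; apply cderiv_scal; [exact Hl|apply cderiv_id].
    - intros z Hz. specialize (Hin z ltac:(lra)). specialize (Hmin z Hin). cbv beta in Hmin.
      assert (Ez : Cmod z * Cmod z = Cmod a * Cmod a + 2 * (Re (Cconj a * z)%C - Cmod a * Cmod a) + r * r).
      { rewrite <- Hz, !Cmod_sqr. unfold Cminus. rewrite re_mult, re_plus, im_plus, re_opp, im_opp.
        simpl. unfold Re, Im. ring. }
      assert (Hcz : Re (c * g z)%C <= Cmod (g z)).
      { rewrite <- (Rmult_1_l (Cmod (g z))), <- Hc, <- Cmod_mult.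
        eapply Rle_trans; [apply Rle_abs|apply re_le_Cmod]. }
      unfold K. rewrite !re_plus, Hca, re_RtoC, <- !Cmult_assoc, !re_scal_l.
      replace (Re (Cconj a * a)%C) with (Cmod a * Cmod a).
      2:{ rewrite Cmod_sqr, re_mult. simpl. unfold Re, Im. ring. }
      nra. }
  intros z Hz. rewrite Eg', Cmod_mult. rewrite <- (Rmult_1_r (Cmod z)) at 2.
  apply Rmult_le_compat_l; [apply Cmod_ge_0|]. apply Rnot_lt_le; intros Hgt.
  pose proof (Cmod_ge_0 z) as Hz0.
  assert (Hi : 0 < / Cmod (g z) < 1).
  { split; [apply Rinv_0_lt_compat; lra|]. rewrite <- Rinv_1. apply Rinv_lt_contravar; lra. }
  set (rho := Rmax (Cmod z) ((1 + / Cmod (g z)) / 2)).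
  assert (Hrho : 0 < rho < 1).
  { unfold rho, Rmax. destruct (Rle_dec (Cmod z) ((1 + / Cmod (g z)) / 2)); lra. }
  specialize (Hmain rho z Hrho (Rmax_l _ _)).
  assert (/ rho < / / Cmod (g z)).
  { apply Rinv_lt_contravar; [nra|]. generalize (Rmax_r (Cmod z) ((1 + / Cmod (g z)) / 2)). fold rho. lra. }
  rewrite Rinv_inv in H. lra.
Qed.

(** * Extremal functions and the radius criterion *)

Lemma is_derive_on_line (f : C -> C) (c p k l : C) (s : R) : cderiv f (p + RtoC s * k)%C l ->
  is_derive (fun s : R => Re (c * f (p + RtoC s * k))%C) s (Re (c * (k * l))%C).
Proof.
  intros Hf. apply is_derive_Reals. intros eps He. rewrite cderiv_iff in Hf.
  set (A := (Cmod c + 1) * (Cmod k + 1)).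
  pose proof (Cmod_ge_0 c) as Hc. pose proof (Cmod_ge_0 k) as Hk.
  assert (HA : 0 < A) by (apply Rmult_lt_0_compat; lra).
  destruct (Hf (eps / (2 * A))) as [d [Hd H]]; [apply Rdiv_lt_0_compat; lra|].
  assert (Hdk : 0 < d / (Cmod k + 1)) by (apply Rdiv_lt_0_compat; lra).
  exists (mkposreal _ Hdk). intros h Hh Hhd. change (Rabs h < d / (Cmod k + 1)) in Hhd.
  assert (E : ((p + RtoC (s + h) * k) - (p + RtoC s * k) = RtoC h * k)%C) by (rewrite RtoC_plus; ring).
  specialize (H (p + RtoC (s + h) * k)%C). rewrite E, Cmod_mult, Cmod_R in H.
  assert (Hlt : Rabs h * Cmod k < d).
  { apply Rmult_lt_compat_r with (r := Cmod k + 1) in Hhd; [|lra].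
    unfold Rdiv in Hhd. rewrite Rmult_assoc, Rinv_l in Hhd by lra. pose proof (Rabs_pos h). nra. }
  specialize (H Hlt).
  set (D := (f (p + RtoC (s + h) * k) - f (p + RtoC s * k) - RtoC h * k * l)%C) in *.
  assert (Hah : 0 < Rabs h) by now apply Rabs_pos_lt.
  replace ((Re (c * f (p + RtoC (s + h) * k))%C - Re (c * f (p + RtoC s * k))%C) / h - Re (c * (k * l))%C)
    with (Re (c * D)%C / h).
  2:{ apply Rmult_eq_reg_r with h; auto. unfold Rdiv. rewrite Rmult_minus_distr_r, !Rmult_assoc, !Rinv_l by auto.
      rewrite !Rmult_1_r. unfold D.
      replace (c * (f (p + RtoC (s + h) * k) - f (p + RtoC s * k) - RtoC h * k * l))%C
        with (c * f (p + RtoC (s + h) * k) - c * f (p + RtoC s * k) - RtoC h * (c * (k * l)))%C by ring.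
      unfold Cminus. rewrite !re_plus, !re_opp, re_scal_l. ring. }
  unfold Rdiv. rewrite Rabs_mult, Rabs_inv.
  apply Rmult_lt_reg_r with (Rabs h); auto. rewrite Rmult_assoc, Rinv_l, Rmult_1_r by lra.
  eapply Rle_lt_trans; [apply re_le_Cmod|]. rewrite Cmod_mult.
  apply Rle_lt_trans with (Cmod c * (eps / (2 * A) * (Rabs h * Cmod k))); [apply Rmult_le_compat_l; auto|].
  apply Rle_lt_trans with (eps / (2 * A) * A * Rabs h).
  - replace (Cmod c * (eps / (2 * A) * (Rabs h * Cmod k))) with (eps / (2 * A) * (Cmod c * Cmod k) * Rabs h) by ring.
    apply Rmult_le_compat_r; [lra|]. apply Rmult_le_compat_l.
    + left; apply Rdiv_lt_0_compat; lra.
    + unfold A; nra.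
  - replace (eps / (2 * A) * A) with (eps / 2) by (field; lra). nra.
Qed.

Lemma continuous_on_ray (g : C -> C) (z : C) (t : R) : ccont g (RtoC t * z)%C ->
  continuous (fun t => Re (g (RtoC t * z)%C)) t /\ continuous (fun t => Im (g (RtoC t * z)%C)) t.
Proof.
  intros Hg. pose proof (Cmod_ge_0 z) as Hz.
  assert (H : forall eps, 0 < eps -> exists d, 0 < d /\ forall x, Rabs (x - t) < d ->
    Cmod (g (RtoC x * z) - g (RtoC t * z))%C < eps).
  { intros eps He. destruct (Hg eps He) as [d [Hd H]]. exists (d / (Cmod z + 1)). split.
    - apply Rdiv_lt_0_compat; lra.
    - intros x Hx. apply H.
      replace (RtoC x * z - RtoC t * z)%C with (RtoC (x - t) * z)%C by (rewrite RtoC_minus; ring).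
      rewrite Cmod_mult, Cmod_R. apply Rmult_lt_compat_r with (r := Cmod z + 1) in Hx; [|lra].
      unfold Rdiv in Hx. rewrite Rmult_assoc, Rinv_l in Hx by lra. pose proof (Rabs_pos (x - t)). nra. }
  split; apply continuity_pt_filterlim; intros eps He; destruct (H eps He) as [d [Hd Hd']];
    exists d; (split; [exact Hd|]); intros x [_ Hx]; simpl in *; unfold Rdist in *;
    eapply Rle_lt_trans; try exact (Hd' x Hx).
  - apply (re_le_Cmod (g (RtoC x * z) - g (RtoC t * z))%C).
  - apply (im_le_Cmod (g (RtoC x * z) - g (RtoC t * z))%C).
Qed.

Lemma cderiv_uniform_on_segment (psi psi1 : C -> C) (z : C) : Cmod z < 1 ->
  (forall p, Cmod p < 1 -> cderiv psi p (psi1 p)) -> (forall p, Cmod p < 1 -> ccont psi1 p) ->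
  forall eta, 0 < eta -> exists d, 0 < d /\ forall t h, 0 <= t <= 1 -> Cmod h < d ->
    Cmod (psi (RtoC t * z + h) - psi (RtoC t * z) - h * psi1 (RtoC t * z))%C <= eta * Cmod h.
Proof.
  intros Hz Hd Hc eta Heta.
  assert (Hin : forall t, 0 <= t <= 1 -> Cmod (RtoC t * z)%C <= Cmod z).
  { intros t Ht. rewrite Cmod_mult, Cmod_R, Rabs_pos_eq by lra. pose proof (Cmod_ge_0 z). nra. }
  pose (P := fun x (_ : R) h (_ : R) => exists d, 0 < d /\ forall t k, x <= t <= x + h -> Cmod k < d ->
    Cmod (psi1 (RtoC t * z + k) - psi1 (RtoC t * z))%C <= eta).
  assert (HP : P 0 0 1 0).
  { apply (rectangle_bisection 0 0 1 0 P); try lra.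
    - intros x y h k _ _ _ _ _ _ [d1 [Hd1 H1]] [d2 [Hd2 H2]] _ _.
      exists (Rmin d1 d2); split; [now apply Rmin_pos|]. intros t k' Ht Hk'.
      apply Rmin_Rgt_l in Hk' as [K1 K2].
      destruct (Rle_dec t (x + h / 2)); [apply H1|apply H2]; auto; lra.
    - intros t0 q Ht0 _. destruct (Hc (RtoC t0 * z)%C ltac:(specialize (Hin t0 ltac:(lra)); lra) (eta / 2) ltac:(lra)) as [d [Hd0 H]].
      exists (d / 2). split; [lra|]. intros x y h k Hh _ _ _ _ _ Hx _.
      exists (d / 2); split; [lra|]. intros t k' Ht Hk'.
      assert (Hs : Cmod (RtoC t * z - RtoC t0 * z)%C < d / 2).
      { replace (RtoC t * z - RtoC t0 * z)%C with (RtoC (t - t0) * z)%C by (rewrite RtoC_minus; ring).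
        rewrite Cmod_mult, Cmod_R. assert (Rabs (t - t0) <= h) by (apply Rabs_le; lra).
        pose proof (Cmod_ge_0 z). pose proof (Rabs_pos (t - t0)). nra. }
      pose proof (H (RtoC t * z)%C ltac:(lra)) as H1.
      assert (H2 : Cmod (psi1 (RtoC t * z + k') - psi1 (RtoC t0 * z))%C < eta / 2).
      { apply H. replace (RtoC t * z + k' - RtoC t0 * z)%C with ((RtoC t * z - RtoC t0 * z) + k')%C by ring.
        eapply Rle_lt_trans; [apply Cmod_triangle|]. lra. }
      replace (psi1 (RtoC t * z + k') - psi1 (RtoC t * z))%C with
        ((psi1 (RtoC t * z + k') - psi1 (RtoC t0 * z)) + - (psi1 (RtoC t * z) - psi1 (RtoC t0 * z)))%C by ring.
      eapply Rle_trans; [apply Cmod_triangle|]. rewrite Cmod_opp. lra. }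
  destruct HP as [d [Hd0 H]].
  exists (Rmin d (1 - Cmod z)); split; [apply Rmin_pos; lra|].
  intros t h Ht Hh. apply Rmin_Rgt_l in Hh as [Hh1 Hh2]. specialize (Hin t Ht).
  set (p := (RtoC t * z)%C) in *.
  set (D := (psi (p + h) - psi p - h * psi1 p)%C).
  destruct (Req_dec (Cmod D) 0) as [HD|HD].
  { rewrite HD. pose proof (Cmod_ge_0 h). nra. }
  assert (HDp : 0 < Cmod D) by (generalize (Cmod_ge_0 D); lra).
  assert (Hnz : RtoC (Cmod D) <> 0%C) by (intros E; apply RtoC_inj in E; lra).
  pose (c := (Cconj D / RtoC (Cmod D))%C).
  assert (Hcm : Cmod c = 1).
  { unfold c, Cdiv. rewrite Cmod_mult, Cmod_inv, Cmod_conj, Cmod_R, Rabs_pos_eq by (auto; lra). field; lra. }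
  assert (HcD : (c * D)%C = RtoC (Cmod D)).
  { transitivity ((D * Cconj D) / RtoC (Cmod D))%C; [unfold c; field; auto|].
    rewrite <- Cmod2_conj. rewrite RtoC_pow. field; auto. }
  pose (phi := fun s : R => Re (c * (psi (p + RtoC s * h) - psi1 p * (p + RtoC s * h)))%C).
  pose (dphi := fun s : R => Re (c * (h * (psi1 (p + RtoC s * h) - psi1 p * 1)))%C).
  assert (Hs : forall s, 0 <= s <= 1 -> Cmod (RtoC s * h)%C <= Cmod h).
  { intros s Hs. rewrite Cmod_mult, Cmod_R, Rabs_pos_eq by lra. pose proof (Cmod_ge_0 h). nra. }
  assert (Hder : forall s, 0 <= s <= 1 -> is_derive phi s (dphi s)).
  { intros s Hs'. specialize (Hs s Hs').
    apply (is_derive_on_line (fun w => psi w - psi1 p * w)%C).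
    apply cderiv_minus; [|apply cderiv_scal, cderiv_id]. apply Hd.
    eapply Rle_lt_trans; [apply Cmod_triangle|]. lra. }
  destruct (MVT_gen phi 0 1 dphi) as [s [Hs1 E]].
  { intros s Hs'. rewrite Rmin_left, Rmax_right in Hs' by lra. apply Hder; lra. }
  { intros s Hs'. rewrite Rmin_left, Rmax_right in Hs' by lra.
    apply derivable_continuous_pt. exists (dphi s). apply is_derive_Reals, Hder; lra. }
  rewrite Rmin_left, Rmax_right in Hs1 by lra. specialize (Hs s Hs1).
  assert (Ephi : phi 1 - phi 0 = Cmod D).
  { rewrite <- (re_RtoC (Cmod D)), <- HcD. unfold phi, D.
    replace (p + RtoC 1 * h)%C with (p + h)%C by ring. replace (p + RtoC 0 * h)%C with p by ring.
    rewrite <- Re_minus. f_equal. ring. }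
  rewrite Ephi in E. rewrite E. rewrite Rminus_0_r, Rmult_1_r.
  unfold dphi. eapply Rle_trans; [apply Rle_abs|]. eapply Rle_trans; [apply re_le_Cmod|].
  rewrite !Cmod_mult, Hcm, Rmult_1_l, Rmult_comm. apply Rmult_le_compat_r; [apply Cmod_ge_0|].
  replace (psi1 (p + RtoC s * h) - psi1 p * 1)%C with (psi1 (p + RtoC s * h) - psi1 p)%C by ring.
  apply H; [lra|]. lra.
Qed.

Definition ray_integral (g : R -> C) : C :=
  (RInt (fun t => Re (g t)) 0 1, RInt (fun t => Im (g t)) 0 1).

Lemma is_RInt_bound (f : R -> R) (I M : R) : is_RInt f 0 1 I ->
  (forall t, 0 <= t <= 1 -> Rabs (f t) <= M) -> Rabs I <= M.
Proof.
  intros HI HM. rewrite <- (is_RInt_unique _ _ _ _ HI).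
  replace M with ((1 - 0) * M) by ring. apply abs_RInt_le_const; auto; [lra|]. now exists I.
Qed.

Lemma is_RInt_ray_integral (g : C -> C) (z : C) :
  (forall t, 0 <= t <= 1 -> ccont g (RtoC t * z)%C) ->
  is_RInt (fun t => Re (g (RtoC t * z)%C)) 0 1 (Re (ray_integral (fun t => g (RtoC t * z)%C))) /\
  is_RInt (fun t => Im (g (RtoC t * z)%C)) 0 1 (Im (ray_integral (fun t => g (RtoC t * z)%C))).
Proof.
  intros H. split; apply (RInt_correct (V := R_CompleteNormedModule)); apply ex_RInt_on_segment; try lra;
    intros t Ht; apply (continuous_on_ray g z t (H t Ht)).
Qed.

(* [L(z)] is the integral of [(psi(t z) - 1) / t] over [0, 1]; differentiating under the integral
   sign gives [L'(z)] as the integral of [psi'(t z)], so that [z L'(z) = psi(z) - 1]. *)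
Lemma logarithmic_primitive (psi psi1 : C -> C) :
  (forall p, Cmod p < 1 -> cderiv psi p (psi1 p)) -> (forall p, Cmod p < 1 -> ccont psi1 p) ->
  psi 0%C = 1%C ->
  exists L : C -> C, L 0%C = 0%C /\
    forall z, Cmod z < 1 -> exists l, cderiv L z l /\ (z * l = psi z - 1)%C.
Proof.
  intros Hd Hc H0.
  destruct (cderiv_slope psi 0%C (psi1 0%C)) as [q [Hq0 [Eq0 Eq]]]; [apply Hd; rewrite Cmod_0; lra|].
  assert (Eq' : forall z, (z * q z = psi z - 1)%C).
  { intros z. rewrite (Eq z), H0. ring. }
  assert (Hqc : forall z : C, Cmod z < 1 -> ccont q z).
  { intros z Hz. destruct (Ceq_dec z 0%C) as [->|Hz0]; auto.
    apply Cmod_gt_0 in Hz0 as Hz0'.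
    apply (ccont_ext_loc (fun y => (psi y + - (1)) * / y)%C q z (Cmod z)); auto.
    - intros y Hy. change (psi y + - (1))%C with (psi y - 1)%C. rewrite <- Eq'. field. intros ->.
      replace (0 - z)%C with (- z)%C in Hy by ring. rewrite Cmod_opp in Hy. lra.
    - apply ccont_mult; [|apply ccont_inv; auto using ccont_id].
      apply ccont_plus; [|apply ccont_const]. apply cderiv_cont with (psi1 z). auto. }
  assert (Hin : forall t z, 0 <= t <= 1 -> Cmod z < 1 -> Cmod (RtoC t * z)%C < 1).
  { intros t z Ht Hz. rewrite Cmod_mult, Cmod_R, Rabs_pos_eq by lra. pose proof (Cmod_ge_0 z). nra. }
  pose (k := fun z t => (z * q (RtoC t * z))%C).
  pose (L := fun z => ray_integral (k z)).
  assert (HL : forall z, Cmod z < 1 -> is_RInt (fun t => Re (k z t)) 0 1 (Re (L z)) /\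
    is_RInt (fun t => Im (k z t)) 0 1 (Im (L z))).
  { intros z Hz. apply (is_RInt_ray_integral (fun w => z * q w)%C z). intros t Ht.
    apply ccont_mult; auto using ccont_const. }
  exists L. split.
  { unfold L, ray_integral, k. apply C_eq; simpl.
    - rewrite (RInt_ext _ (fun _ => 0)), RInt_const.
      + unfold scal; simpl; unfold mult; simpl; ring.
      + intros x _. match goal with |- ?a = ?b => change (@eq R a b) end. ring.
    - rewrite (RInt_ext _ (fun _ => 0)), RInt_const.
      + unfold scal; simpl; unfold mult; simpl; ring.
      + intros x _. match goal with |- ?a = ?b => change (@eq R a b) end. ring. }
  intros z Hz. set (l := ray_integral (fun t => psi1 (RtoC t * z)%C)).
  destruct (is_RInt_ray_integral psi1 z) as [Ir Ii]; [auto|]. fold l in Ir, Ii.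
  exists l. split.
  - apply cderiv_iff. intros eps He.
    destruct (cderiv_uniform_on_segment psi psi1 z Hz Hd Hc (eps / 2) ltac:(lra)) as [d [Hd0 H]].
    exists (Rmin d (1 - Cmod z)); split; [apply Rmin_pos; lra|].
    intros y Hy. apply Rmin_Rgt_l in Hy as [Hy1 Hy2]. set (h := (y - z)%C) in *.
    assert (Hy : Cmod y < 1).
    { replace y with (z + h)%C by (unfold h; ring). eapply Rle_lt_trans; [apply Cmod_triangle|]. lra. }
    assert (Hk : forall t, 0 <= t <= 1 -> Cmod (k y t - k z t - h * psi1 (RtoC t * z))%C <= eps / 2 * Cmod h).
    { intros t Ht. destruct (Req_dec t 0) as [->|Ht0].
      - unfold k. replace (RtoC 0 * y)%C with (RtoC 0) by ring. replace (RtoC 0 * z)%C with (RtoC 0) by ring.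
        rewrite Eq0. replace (y * psi1 0 - z * psi1 0 - h * psi1 0)%C with (RtoC 0) by (unfold h; ring).
        rewrite Cmod_0. pose proof (Cmod_ge_0 h). nra.
      - assert (Hth : Cmod (RtoC t * h)%C = t * Cmod h) by (rewrite Cmod_mult, Cmod_R, Rabs_pos_eq; lra).
        pose proof (Cmod_ge_0 h).
        specialize (H t (RtoC t * h)%C Ht ltac:(rewrite Hth; nra)). rewrite Hth in H.
        apply Rmult_le_reg_l with t; [lra|].
        rewrite <- (Rabs_pos_eq t) at 1 by lra. rewrite <- Cmod_R, <- Cmod_mult.
        replace (t * (eps / 2 * Cmod h)) with (eps / 2 * (t * Cmod h)) by ring.
        eapply Rle_trans; [|exact H]. right. f_equal.
        replace (RtoC t * z + RtoC t * h)%C with (RtoC t * y)%C by (unfold h; ring).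
        transitivity ((RtoC t * y) * q (RtoC t * y) - (RtoC t * z) * q (RtoC t * z) - RtoC t * h * psi1 (RtoC t * z))%C.
        + unfold k; ring.
        + rewrite !Eq'. ring. }
    destruct (HL y Hy) as [A1 A2]. destruct (HL z Hz) as [B1 B2].
    assert (G1 : Rabs (Re (L y - L z - h * l)%C) <= eps / 2 * Cmod h).
    { apply is_RInt_bound with (fun t => Re (k y t - k z t - h * psi1 (RtoC t * z))%C).
      - eapply is_RInt_ext.
        2:{ replace (Re (L y - L z - h * l)%C) with (minus (minus (Re (L y)) (Re (L z))) (minus (scal (Re h) (Re l)) (scal (Im h) (Im l)))).
            - apply (is_RInt_minus (V := R_NormedModule)); [apply (is_RInt_minus (V := R_NormedModule)); [exact A1|exact B1]|].
              apply (is_RInt_minus (V := R_NormedModule)); apply (is_RInt_scal (V := R_NormedModule)); [exact Ir|exact Ii].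
            - unfold Cminus. rewrite !re_plus, !re_opp, re_mult. reflexivity. }
        intros t _. unfold Cminus. rewrite !re_plus, !re_opp, re_mult. reflexivity.
      - intros t Ht. eapply Rle_trans; [apply re_le_Cmod|auto]. }
    assert (G2 : Rabs (Im (L y - L z - h * l)%C) <= eps / 2 * Cmod h).
    { apply is_RInt_bound with (fun t => Im (k y t - k z t - h * psi1 (RtoC t * z))%C).
      - eapply is_RInt_ext.
        2:{ replace (Im (L y - L z - h * l)%C) with (minus (minus (Im (L y)) (Im (L z))) (plus (scal (Re h) (Im l)) (scal (Im h) (Re l)))).
            - apply (is_RInt_minus (V := R_NormedModule)); [apply (is_RInt_minus (V := R_NormedModule)); [exact A2|exact B2]|].
              apply (is_RInt_plus (V := R_NormedModule)); apply (is_RInt_scal (V := R_NormedModule)); [exact Ii|exact Ir].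
            - unfold Cminus. rewrite !im_plus, !im_opp, im_mult. reflexivity. }
        intros t _. unfold Cminus. rewrite !im_plus, !im_opp, im_mult. reflexivity.
      - intros t Ht. eapply Rle_trans; [apply im_le_Cmod|auto]. }
    eapply Rle_trans; [apply Cmod_le_abs|]. lra.
  - assert (F : forall c : C, Re (c * (z * l))%C = Re (c * (psi z - 1))%C).
    { intros c.
      assert (F1 : is_RInt (fun t => Re (c * (z * psi1 (0 + RtoC t * z)))%C) 0 1
        (minus (Re (c * psi (0 + RtoC 1 * z))%C) (Re (c * psi (0 + RtoC 0 * z))%C))).
      { apply (is_RInt_derive (V := R_CompleteNormedModule) (fun t => Re (c * psi (0 + RtoC t * z))%C)).
        - intros t Ht. rewrite Rmin_left, Rmax_right in Ht by lra. apply is_derive_on_line. apply Hd.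
          rewrite Cplus_0_l. auto.
        - intros t Ht. rewrite Rmin_left, Rmax_right in Ht by lra.
          apply (continuous_on_ray (fun w => c * (z * psi1 (0 + w)))%C z t).
          apply ccont_mult; [apply ccont_const|]. apply ccont_mult; [apply ccont_const|].
          apply (ccont_comp (fun w => 0 + w)%C psi1).
          + apply ccont_plus; auto using ccont_const, ccont_id.
          + rewrite Cplus_0_l. auto. }
      assert (F2 : is_RInt (fun t => Re (c * (z * psi1 (0 + RtoC t * z)))%C) 0 1 (Re (c * (z * l))%C)).
      { eapply is_RInt_ext.
        2:{ replace (Re (c * (z * l))%C) with (minus (scal (Re (c * z)%C) (Re l)) (scal (Im (c * z)%C) (Im l))).
            - apply (is_RInt_minus (V := R_NormedModule)); apply (is_RInt_scal (V := R_NormedModule)); [exact Ir|exact Ii].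
            - rewrite Cmult_assoc, re_mult. reflexivity. }
        intros t _. rewrite Cplus_0_l, Cmult_assoc, (re_mult (c * z)%C). reflexivity. }
      rewrite <- (is_RInt_unique _ _ _ _ F2), (is_RInt_unique _ _ _ _ F1).
      replace (0 + RtoC 1 * z)%C with z by ring. replace (0 + RtoC 0 * z)%C with (RtoC 0) by ring.
      rewrite H0. change (Re (c * psi z)%C - Re (c * 1)%C = Re (c * (psi z - 1))%C).
      rewrite <- Re_minus. f_equal. ring. }
    apply C_eq.
    + specialize (F 1%C). now rewrite !Cmult_1_l in F.
    + specialize (F Complex.Ci). rewrite !(Cmult_comm Complex.Ci), !re_mult_Ci in F. lra.
Qed.

Lemma starlike_extremal (psi psi1 : C -> C) :
  (forall p, Cmod p < 1 -> cderiv psi p (psi1 p)) -> (forall p, Cmod p < 1 -> ccont psi1 p) ->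
  psi 0%C = 1%C ->
  exists f df : C -> C, starlike psi f /\ forall z, Cmod z < 1 ->
    cderiv f z (df z) /\ (z <> 0%C -> f z <> 0%C /\ (z * df z / f z = psi z)%C).
Proof.
  intros Hd Hc H0. destruct (logarithmic_primitive psi psi1 Hd Hc H0) as [L [HL0 HL]].
  pose (f := fun z => (z * Cexp (L z))%C). pose (df := fun z => (psi z * Cexp (L z))%C).
  assert (Hf : forall z, Cmod z < 1 -> cderiv f z (df z)).
  { intros z Hz. destruct (HL z Hz) as [l [Hl E]].
    eapply cderiv_val; [|apply cderiv_mult; [apply cderiv_id|]].
    2:{ apply (cderiv_comp L Cexp); [exact Hl|apply cderiv_Cexp]. }
    cbv beta. unfold df. replace (psi z) with (z * l + 1)%C by (rewrite E; ring). ring. }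
  assert (Hne : forall z : C, z <> 0%C -> f z <> 0%C).
  { intros z Hz. apply Cmult_neq_0; auto using Cexp_neq_0. }
  assert (Hq : forall z : C, z <> 0%C -> (z * df z / f z = psi z)%C).
  { intros z Hz. unfold df, f. field. split; auto using Cexp_neq_0. }
  exists f, df. split.
  - split.
    + split; [|split].
      * intros z Hz. exists (df z). now apply Hf.
      * unfold f. ring.
      * replace (RtoC 1) with (df 0%C); [apply Hf; rewrite Cmod_0; lra|].
        unfold df. rewrite H0, HL0, Cexp_0. ring.
    + exists df. split; [exact Hf|]. split; [intros z _; apply Hne|].
      exists (fun z => z). repeat split; auto.
      * intros z _. exists (RtoC 1). apply cderiv_id.
      * intros z _. destruct (Ceq_dec z (RtoC 0)) as [->|Hz]; auto.
  - intros z Hz. split; auto.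
Qed.

Lemma is_radius_of_disk (psi psi1 : C -> C) (r0 : R) :
  (forall p, Cmod p < 1 -> cderiv psi p (psi1 p)) -> (forall p, Cmod p < 1 -> ccont psi1 p) ->
  psi 0%C = 1%C -> 0 < r0 < 1 -> psi (RtoC (- r0)) = RtoC (1 - / exp 1) ->
  (forall z, Cmod z < r0 -> Cmod (psi z - 2)%C < 1 + / exp 1) ->
  is_radius (starlike wp) (starlike psi) r0.
Proof.
  intros Hd Hc H0 Hr0 Hcusp Hdisk. split; [lra|split].
  - intros r Hr f [[Hfa [Hf0 Hf1]] [df [Hdf [Hne [w [Hw [Hw0 [HwD Hsub]]]]]]]].
    assert (Hrz : forall z, Cmod z < 1 -> Cmod (RtoC r * z)%C < r).
    { intros z Hz. rewrite Cmod_mult, Cmod_R, Rabs_pos_eq by lra. nra. }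
    assert (Hrn : RtoC r <> 0%C) by (intros E; apply RtoC_inj in E; lra).
    assert (HF : forall z l, cderiv f (RtoC r * z)%C l -> cderiv (fun z => f (RtoC r * z) / RtoC r)%C z l).
    { intros z l Hl. eapply cderiv_val; [|apply cderiv_div; [|apply cderiv_const|exact Hrn]].
      2:{ apply (cderiv_comp (fun z => RtoC r * z)%C f); [apply cderiv_scal, cderiv_id|exact Hl]. }
      cbv beta. field. auto. }
    destruct zexp_analytic_inverse as [V HV].
    assert (Hu : forall z, Cmod z < 1 -> Cmod (psi (w (RtoC r * z)) - 1 - 1)%C < 1 + / exp 1).
    { intros z Hz. specialize (Hrz z Hz).
      replace (psi (w (RtoC r * z)) - 1 - 1)%C with (psi (w (RtoC r * z)) - 2)%C.
      2:{ replace (RtoC 2) with (1 + 1)%C; [ring|]. rewrite <- RtoC_plus. f_equal; ring. }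
      apply Hdisk. eapply Rle_lt_trans; [apply (schwarz w Hw Hw0 HwD)|]; unfold inD; lra. }
    assert (Hw1 : forall z, Cmod z < 1 -> Cmod (w (RtoC r * z)%C) < 1).
    { intros z Hz. apply HwD. unfold inD. specialize (Hrz z Hz). lra. }
    split; [split; [|split]|].
    + intros z Hz. exists (df (RtoC r * z)%C). apply HF, Hdf. unfold inD in *. specialize (Hrz z Hz). lra.
    + cbv beta. rewrite Cmult_0_r, Hf0. field. auto.
    + apply HF. now rewrite Cmult_0_r.
    + exists (fun z => df (RtoC r * z)%C). split; [|split].
      * intros z Hz. apply HF, Hdf. unfold inD in *. specialize (Hrz z Hz). lra.
      * intros z Hz Hz0 E. apply (Hne (RtoC r * z)%C).
        -- unfold inD in *. specialize (Hrz z Hz). lra.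
        -- now apply Cmult_neq_0.
        -- replace (f (RtoC r * z)%C) with (f (RtoC r * z) / RtoC r * RtoC r)%C by (field; auto).
           rewrite E. ring.
      * exists (fun z => V (psi (w (RtoC r * z)) - 1)%C). split; [|split; [|split]].
        -- intros z Hz. destruct (HV _ (Hu z Hz)) as [_ [_ [l Hl]]].
           destruct (Hw (RtoC r * z)%C) as [lw Hlw]; [unfold inD in *; specialize (Hrz z Hz); lra|].
           eexists. apply (cderiv_comp (fun z => psi (w (RtoC r * z)) - 1)%C V); [|exact Hl].
           apply cderiv_minus; [|apply cderiv_const].
           apply (cderiv_comp (fun z => w (RtoC r * z)%C) psi); [|apply Hd, Hw1, Hz].
           apply (cderiv_comp (fun z => RtoC r * z)%C w); [apply cderiv_scal, cderiv_id|exact Hlw].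
        -- assert (Hz0 : Cmod (RtoC 0) < 1) by (rewrite Cmod_0; lra).
           destruct (HV _ (Hu _ Hz0)) as [V1 [V2 _]]. apply zexp_inj; auto.
           rewrite V2, Cmult_0_r, Hw0, H0. unfold zexp. ring.
        -- intros z Hz. apply HV, Hu, Hz.
        -- intros z Hz. destruct (HV _ (Hu z Hz)) as [_ [V2 _]]. unfold zexp in V2. unfold wp. rewrite V2.
           transitivity (psi (w (RtoC r * z)%C)); [|ring].
           rewrite <- Hsub by (unfold inD in *; specialize (Hrz z Hz); lra).
           destruct (Ceq_dec z (RtoC 0)) as [->|Hz0].
           ++ rewrite Cmult_0_r. destruct (Ceq_dec (RtoC 0) (RtoC 0)); [reflexivity|congruence].
           ++ destruct (Ceq_dec (RtoC r * z)%C (RtoC 0)) as [E|E].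
              ** exfalso. now apply (Cmult_neq_0 _ _ Hrn Hz0).
              ** field. split; auto. apply Hne; auto. unfold inD in *. specialize (Hrz z Hz). lra.
  - intros r1 Hr1 Hall.
    destruct (starlike_extremal psi psi1 Hd Hc H0) as [f [df [Hf Hfd]]].
    destruct (Hall r1 ltac:(lra) f Hf) as [_ [dF [HdF [_ [v [_ [_ [HvD Hv]]]]]]]].
    set (z := RtoC (- (r0 / r1))).
    assert (Hq : 0 < r0 / r1 < 1).
    { split; [apply Rdiv_lt_0_compat; lra|]. apply Rmult_lt_reg_r with r1; [lra|].
      unfold Rdiv. rewrite Rmult_assoc, Rinv_l; lra. }
    assert (Hz : inD z) by (unfold inD, z; rewrite Cmod_R, Rabs_Ropp, Rabs_pos_eq; lra).
    assert (Ez : (RtoC r1 * z)%C = RtoC (- r0)).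
    { unfold z. rewrite <- RtoC_mult. f_equal. field. lra. }
    assert (Hr0m : Cmod (RtoC (- r0)) < 1) by (rewrite Cmod_R, Rabs_Ropp, Rabs_pos_eq; lra).
    destruct (Hfd _ Hr0m) as [Hf1 Hf2].
    assert (Hn0 : RtoC (- r0) <> 0%C) by (intros E; apply RtoC_inj in E; lra).
    assert (Hrn : RtoC r1 <> 0%C) by (intros E; apply RtoC_inj in E; lra).
    destruct (Hf2 Hn0) as [Hf3 Hf4].
    assert (EdF : dF z = df (RtoC (- r0))).
    { apply (cderiv_unique (fun z => f (RtoC r1 * z) / RtoC r1)%C z); [now apply HdF|].
      eapply cderiv_val; [|apply cderiv_div; [|apply cderiv_const|exact Hrn]].
      2:{ apply (cderiv_comp (fun z => RtoC r1 * z)%C f); [apply cderiv_scal, cderiv_id|].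
          rewrite Ez. exact Hf1. }
      cbv beta. field. auto. }
    specialize (Hv z Hz). cbv beta in Hv.
    destruct (Ceq_dec z (RtoC 0)) as [E|Hzn].
    { unfold z in E. apply RtoC_inj in E. lra. }
    rewrite EdF, Ez in Hv.
    apply (zexp_neq_cusp (v z) (HvD z Hz)). unfold zexp.
    transitivity (wp (v z) - 1)%C; [unfold wp; ring|]. rewrite <- Hv.
    transitivity (psi (RtoC (- r0)) - 1)%C.
    + rewrite <- Hf4, <- Ez. field. rewrite Ez. auto.
    + rewrite Hcusp, <- RtoC_minus. f_equal. ring.
Qed.

(** * The six radii *)

Lemma Csqrt_sqr (z : C) : (Csqrt z * Csqrt z)%C = z.
Proof.
  pose proof (re_le_Cmod z) as H. apply Rabs_le_between in H. pose proof (Cmod_sqr z) as E.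
  assert (H1 : 0 <= (Cmod z + Re z) / 2) by lra. assert (H2 : 0 <= (Cmod z - Re z) / 2) by lra.
  pose proof (sqrt_sqrt _ H1) as S1. pose proof (sqrt_sqrt _ H2) as S2.
  assert (S12 : sqrt ((Cmod z + Re z) / 2) * sqrt ((Cmod z - Re z) / 2) = Rabs (Im z) / 2).
  { rewrite <- sqrt_mult by auto.
    replace ((Cmod z + Re z) / 2 * ((Cmod z - Re z) / 2)) with (Rsqr (Im z / 2)).
    - rewrite sqrt_Rsqr_abs. unfold Rdiv. rewrite Rabs_mult, (Rabs_pos_eq (/ 2)); lra.
    - unfold Rsqr. nra. }
  apply C_eq; rewrite ?re_mult, ?im_mult; unfold Csqrt; simpl (Re (_, _)); simpl (Im (_, _)).
  - destruct (Rlt_dec (Im z) 0); lra.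
  - unfold Rabs in S12. destruct (Rlt_dec (Im z) 0), (Rcase_abs (Im z)); lra.
Qed.

Lemma Csqrt_Re_pos (z : C) : 0 < Re z -> 0 < Re (Csqrt z).
Proof.
  intros Hz. pose proof (re_le_Cmod z) as H. apply Rabs_le_between in H.
  unfold Csqrt; simpl. apply sqrt_lt_R0. lra.
Qed.

Lemma Csqrt_neq_0 (z : C) : 0 < Re z -> Csqrt z <> 0%C.
Proof.
  intros Hz E. pose proof (Csqrt_Re_pos z Hz) as H. rewrite E in H. simpl in H. lra.
Qed.

Lemma Csqrt_RtoC_sqr (x : R) : 0 < x -> Csqrt (RtoC (x * x)) = RtoC x.
Proof.
  intros Hx. set (s := Csqrt (RtoC (x * x))).
  assert (Hs : 0 < Re s) by (apply Csqrt_Re_pos; simpl; nra).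
  assert (E : ((s - RtoC x) * (s + RtoC x))%C = 0%C).
  { transitivity (s * s - RtoC x * RtoC x)%C; [ring|]. unfold s. rewrite Csqrt_sqr, RtoC_mult. ring. }
  destruct (Ceq_dec (s - RtoC x)%C 0%C) as [H|H].
  - transitivity ((s - RtoC x) + RtoC x)%C; [ring|rewrite H; ring].
  - exfalso. apply (Cmult_neq_0 _ (s + RtoC x)%C H); auto. intros H'.
    apply (f_equal Re) in H'. rewrite re_plus, !re_RtoC in H'. lra.
Qed.

Lemma ccont_Csqrt (p : C) : 0 < Re p -> ccont Csqrt p.
Proof.
  intros Hp eps He. pose proof (Csqrt_Re_pos p Hp) as Hq. set (q := Re (Csqrt p)) in *.
  exists (Rmin (Re p) (eps * q)). split; [apply Rmin_pos; auto; now apply Rmult_lt_0_compat|].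
  intros z Hz. apply Rmin_Rgt_l in Hz as [H1 H2].
  assert (Hz : 0 < Re z).
  { pose proof (re_le_Cmod (z - p)%C) as H. rewrite Re_minus in H. apply Rabs_le_between in H. lra. }
  pose proof (Csqrt_Re_pos z Hz) as Hqz.
  assert (E : (z - p = (Csqrt z - Csqrt p) * (Csqrt z + Csqrt p))%C).
  { transitivity (Csqrt z * Csqrt z - Csqrt p * Csqrt p)%C; [now rewrite !Csqrt_sqr|ring]. }
  rewrite E, Cmod_mult in H2.
  assert (Hs : q < Cmod (Csqrt z + Csqrt p)%C).
  { pose proof (re_le_Cmod (Csqrt z + Csqrt p)%C) as H. rewrite re_plus in H.
    apply Rabs_le_between in H. fold q in H. lra. }
  pose proof (Cmod_ge_0 (Csqrt z - Csqrt p)%C). nra.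
Qed.

Lemma cderiv_Csqrt (p : C) : 0 < Re p -> cderiv Csqrt p (/ (2 * Csqrt p))%C.
Proof.
  intros Hp. apply (cderiv_right_inverse (fun w => w * w)%C).
  - now apply ccont_Csqrt.
  - eapply cderiv_val; [|apply cderiv_mult; apply cderiv_id]. cbv beta.
    replace (RtoC 2) with (1 + 1)%C by (rewrite <- RtoC_plus; f_equal; ring). ring.
  - apply Cmult_neq_0; [|now apply Csqrt_neq_0]. intros E. apply RtoC_inj in E. lra.
  - exists 1. split; [lra|]. intros z _. apply Csqrt_sqr.
Qed.

Lemma disk_shift (u : C) (r : R) : Cmod (u - 1)%C < r -> Cmod (u - 2)%C < 1 + r.
Proof.
  intros H. replace (u - 2)%C with ((u - 1) + - (1))%C.
  - eapply Rle_lt_trans; [apply Cmod_triangle|]. rewrite Cmod_opp, Cmod_1. lra.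
  - replace (RtoC 2) with (1 + 1)%C by (rewrite <- RtoC_plus; f_equal; ring). ring.
Qed.

Lemma Re_1_plus_pos (z : C) : Cmod z < 1 -> 0 < Re (1 + z)%C.
Proof.
  intros Hz. rewrite re_plus, re_RtoC. pose proof (re_le_Cmod z) as H. apply Rabs_le_between in H. lra.
Qed.

Lemma radius_L : is_radius (starlike wp) (starlike psiL) ((2 * exp 1 - 1) / (exp 1 ^ 2)).
Proof.
  pose proof exp_1_bounds as He. pose proof inv_exp_1_bounds as Hi.
  set (m := 1 - / exp 1).
  assert (E : (2 * exp 1 - 1) / (exp 1 ^ 2) = 1 - m * m) by (unfold m; field; lra).
  rewrite E. assert (Hm : 0.632 < m < 0.6323) by (unfold m; lra).
  apply is_radius_of_disk with (fun z => / (2 * Csqrt (1 + z)))%C.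
  - intros p Hp. unfold psiL. eapply cderiv_val; [|apply (cderiv_comp (fun z => 1 + z)%C Csqrt)].
    2:{ apply cderiv_plus; [apply cderiv_const|apply cderiv_id]. }
    2:{ apply cderiv_Csqrt. now apply Re_1_plus_pos. }
    cbv beta. ring.
  - intros p Hp. pose proof (Re_1_plus_pos p Hp) as H. apply ccont_inv.
    + apply ccont_mult; [apply ccont_const|]. apply (ccont_comp (fun z => 1 + z)%C Csqrt).
      * apply ccont_plus; auto using ccont_const, ccont_id.
      * now apply ccont_Csqrt.
    + apply Cmult_neq_0; [|now apply Csqrt_neq_0]. intros E'. apply RtoC_inj in E'. lra.
  - unfold psiL. rewrite Cplus_0_r. rewrite <- (Rmult_1_l 1) at 1. apply Csqrt_RtoC_sqr. lra.
  - nra.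
  - unfold psiL. rewrite <- RtoC_plus. replace (1 + - (1 - m * m)) with (m * m) by ring.
    apply Csqrt_RtoC_sqr. lra.
  - intros z Hz. apply disk_shift. replace (/ exp 1) with (1 - m) by (unfold m; ring).
    unfold psiL. set (s := Csqrt (1 + z)%C).
    assert (Hz1 : Cmod z < 1) by nra.
    assert (HX : 0 < Re s) by (apply Csqrt_Re_pos; now apply Re_1_plus_pos).
    assert (Es : (s * s = 1 + z)%C) by apply Csqrt_sqr.
    assert (HR : Re s * Re s - Im s * Im s = 1 + Re z).
    { rewrite <- re_mult, Es, re_plus, re_RtoC. reflexivity. }
    pose proof (re_le_Cmod z) as Hre. apply Rabs_le_between in Hre.
    assert (HXm : m < Re s) by nra.
    assert (Ez : Cmod z = Cmod (s - 1)%C * Cmod (s + 1)%C).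
    { rewrite <- Cmod_mult. f_equal. transitivity (s * s - 1)%C; [rewrite Es|]; ring. }
    assert (Hp : 1 + m < Cmod (s + 1)%C).
    { pose proof (re_le_Cmod (s + 1)%C) as H. rewrite re_plus, re_RtoC in H.
      apply Rabs_le_between in H. lra. }
    pose proof (Cmod_ge_0 (s - 1)%C). nra.
Qed.

Lemma Re_div_pos (a b : C) : b <> 0%C -> 0 < Re (a * Cconj b)%C -> 0 < Re (a / b)%C.
Proof.
  intros Hb H. apply Cmod_gt_0 in Hb as Hb'.
  assert (Hn : (b * Cconj b = RtoC (Cmod b ^ 2))%C) by (rewrite <- Cmod2_conj; reflexivity).
  assert (Hc : Cconj b <> 0%C) by (apply Cmod_gt_0; now rewrite Cmod_conj).
  replace (a / b)%C with ((a * Cconj b) * RtoC (/ (Cmod b ^ 2)))%C.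
  - rewrite re_scal_r. apply Rmult_lt_0_compat; auto. apply Rinv_0_lt_compat. simpl; nra.
  - rewrite RtoC_inv by (simpl; nra). rewrite <- Hn. field. auto.
Qed.

Lemma sqrt_2_bounds : 1.4142 < sqrt 2 < 1.4143.
Proof.
  assert (H : sqrt 2 * sqrt 2 = 2) by (apply sqrt_sqrt; lra).
  assert (0 <= sqrt 2) by apply sqrt_pos. nra.
Qed.

Lemma mobius_denominator_neq_0 (b : R) (z : C) : 0 < b < 1 -> Cmod z < 1 -> (1 + RtoC b * z)%C <> 0%C.
Proof.
  intros Hb Hz H. apply (f_equal Re) in H. rewrite re_plus, re_scal_l, !re_RtoC in H.
  pose proof (re_le_Cmod z) as H1. apply Rabs_le_between in H1. nra.
Qed.

Lemma Re_mobius_pos (b : R) (z : C) : 0 < b < 1 -> Cmod z < 1 ->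
  0 < Re ((1 - z) / (1 + RtoC b * z))%C.
Proof.
  intros Hb Hz. apply Re_div_pos; [now apply mobius_denominator_neq_0|].
  pose proof (re_le_Cmod z) as H1. apply Rabs_le_between in H1. pose proof (Cmod_sqr z) as Hs.
  pose proof (Cmod_ge_0 z) as H0.
  rewrite re_mult. simpl. change (fst z) with (Re z). change (snd z) with (Im z).
  match goal with |- 0 < ?r => replace r with ((1 - Re z) * (1 - b) + b * (1 - (Re z * Re z + Im z * Im z))) end.
  - rewrite <- Hs. assert (0 <= (1 - Re z) * (1 - b)) by (apply Rmult_le_pos; lra).
    assert (0 < b * (1 - Cmod z * Cmod z)) by (apply Rmult_lt_0_compat; nra). lra.
  - ring.
Qed.

(* With [y = 1 + eta], [D = |eta|^2] and [X = Re eta], the polynomial below is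
   [|1 - y^2|^2 - r^2 |1 + 2 k y^2|^2]; it is concave in [X] and nonnegative at [X = -1] and
   [X = sqrt D]. *)
Lemma RL_polynomial (k r X dl : R) : 0 < k -> 0 < r -> 0 < dl -> -1 <= X <= dl ->
  let D := dl * dl in let A := 1 + 2 * k in
  2 * k * r < 1 -> r * A <= (2 * dl + D) * (1 - 2 * k * r) -> r * A <= D * (1 + 2 * k * r) ->
  r * r * (A * A + 16 * k * k * D + 4 * k * k * D * D + 8 * A * k * X
    + 4 * A * k * (2 * X * X - D) + 16 * k * k * D * X) <= D * (4 + 4 * X + D).
Proof.
  intros Hk Hr Hdl HX D A Hkr H1 H2.
  pose (Q := fun X => D * (4 + 4 * X + D) - r * r * (A * A + 16 * k * k * D + 4 * k * k * D * D
    + 8 * A * k * X + 4 * A * k * (2 * X * X - D) + 16 * k * k * D * X)).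
  assert (HA : 1 < A) by (unfold A; lra). assert (HD : 0 < D) by (unfold D; nra).
  assert (Q1 : Q (-1) = (D * (1 + 2 * k * r) - r * A) * (D * (1 - 2 * k * r) + r * A)) by (unfold Q; ring).
  assert (Q2 : Q dl = ((2 * dl + D) * (1 - 2 * k * r) - r * A) * ((2 * dl + D) * (1 + 2 * k * r) + r * A)).
  { unfold Q, D, A. ring. }
  assert (P1 : 0 <= Q (-1)).
  { rewrite Q1. apply Rmult_le_pos; [lra|]. assert (0 < r * A) by nra.
    assert (0 < D * (1 - 2 * k * r)) by (apply Rmult_lt_0_compat; lra). lra. }
  assert (P2 : 0 <= Q dl).
  { rewrite Q2. apply Rmult_le_pos; [lra|]. assert (0 < r * A) by nra.
    assert (0 < (2 * dl + D) * (1 + 2 * k * r)) by (apply Rmult_lt_0_compat; nra). lra. }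
  assert (I : Q X * (dl + 1) = Q (-1) * (dl - X) + Q dl * (X + 1)
    + 8 * A * k * (r * r) * ((dl - X) * (X + 1)) * (dl + 1)) by (unfold Q; ring).
  assert (T1 : 0 <= Q (-1) * (dl - X)) by (apply Rmult_le_pos; lra).
  assert (T2 : 0 <= Q dl * (X + 1)) by (apply Rmult_le_pos; lra).
  assert (T3 : 0 <= 8 * A * k * (r * r) * ((dl - X) * (X + 1)) * (dl + 1)).
  { repeat apply Rmult_le_pos; lra. }
  enough (0 <= Q X) by (unfold Q in *; lra). nra.
Qed.

Lemma radius_RL : is_radius (starlike wp) (starlike psiRL)
    ((1 + 2 * (sqrt 2 - 1) * exp 1) /
     (exp 1 ^ 2 * (sqrt 2 - 1) *
      (sqrt 2 - 1 + 2 * (sqrt 2 - 1 + / exp 1) ^ 2))).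
Proof.
  pose proof exp_1_bounds as He. pose proof inv_exp_1_bounds as Hi. pose proof sqrt_2_bounds as H2.
  pose (k := sqrt 2 - 1). pose (c := / exp 1). pose (d := c / k). pose (Y := 1 + d).
  assert (Hk : 0.4142 < k < 0.4143) by (unfold k; lra). assert (Hc : 0.3677 < c < 0.368) by exact Hi.
  assert (Hdk : d * k = c) by (unfold d; field; lra).
  assert (Hd : 0.8875 < d < 0.8885) by nra.
  pose (r := (Y * Y - 1) / (1 + 2 * k * (Y * Y))).
  assert (HB : 0 < 1 + 2 * k * (Y * Y)) by (unfold Y; nra).
  assert (E : (1 + 2 * (sqrt 2 - 1) * exp 1) / (exp 1 ^ 2 * (sqrt 2 - 1) *
      (sqrt 2 - 1 + 2 * (sqrt 2 - 1 + / exp 1) ^ 2)) = r).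
  { fold k. fold c. replace (exp 1) with (/ c) by (unfold c; apply Rinv_inv).
    unfold r, Y, d. field. assert (0 < 2 * (k + c) ^ 2) by (simpl; nra). repeat split; try nra.  }
  rewrite E.
  assert (Er : r * (1 + 2 * k * (Y * Y)) = Y * Y - 1) by (unfold r; field; lra).
  assert (HY : 1.8875 < Y < 1.8885) by (unfold Y; lra).
  assert (HYY : 3.5626 < Y * Y < 3.5665) by nra.
  assert (HkY : 1.4756 < k * (Y * Y) < 1.4777) by nra.
  assert (Hr : 0.64 < r < 0.66) by nra.
  assert (Hb : 0 < 2 * k < 1) by lra.
  pose (M1 := fun z => (((0 - 1) * (1 + RtoC (2 * k) * z) - (1 - z) * (0 + RtoC (2 * k) * 1))
     / ((1 + RtoC (2 * k) * z) * (1 + RtoC (2 * k) * z)))%C).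
  apply is_radius_of_disk with
    (fun z => (0 - RtoC k * (M1 z * / (2 * Csqrt ((1 - z) / (1 + RtoC (2 * k) * z)))))%C).
  - intros p Hp. unfold psiRL. fold k. apply cderiv_minus; [apply cderiv_const|].
    apply cderiv_scal. apply (cderiv_comp (fun z => (1 - z) / (1 + RtoC (2 * k) * z))%C Csqrt).
    + unfold M1. apply (cderiv_div (fun z => 1 - z)%C (fun z => 1 + RtoC (2 * k) * z)%C).
      * apply cderiv_minus; [apply cderiv_const|apply cderiv_id].
      * apply cderiv_plus; [apply cderiv_const|apply cderiv_scal, cderiv_id].
      * now apply mobius_denominator_neq_0.
    + apply cderiv_Csqrt. now apply Re_mobius_pos.
  - intros p Hp. pose proof (mobius_denominator_neq_0 _ p Hb Hp) as Hn. pose proof (Re_mobius_pos _ p Hb Hp) as Hpos.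
    assert (C1 : ccont (fun z => 1 + RtoC (2 * k) * z)%C p).
    { apply ccont_plus; [apply ccont_const|]. apply ccont_mult; auto using ccont_const, ccont_id. }
    assert (C2 : ccont (fun z => 1 - z)%C p).
    { apply ccont_plus; [apply ccont_const|]. apply ccont_opp, ccont_id. }
    unfold Cminus at 1. apply ccont_plus; [apply ccont_const|]. apply ccont_opp.
    apply ccont_mult; [apply ccont_const|]. apply ccont_mult.
    + unfold M1. apply ccont_mult; [|apply ccont_inv; [now apply ccont_mult|now apply Cmult_neq_0]].
      apply ccont_plus; [apply ccont_mult; auto using ccont_const|].
      apply ccont_opp. apply ccont_mult; auto using ccont_const.
    + apply ccont_inv; [|apply Cmult_neq_0; [intros E'; apply RtoC_inj in E'; lra|now apply Csqrt_neq_0]].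
      apply ccont_mult; [apply ccont_const|].
      apply (ccont_comp (fun z => (1 - z) / (1 + RtoC (2 * k) * z))%C Csqrt); [|now apply ccont_Csqrt].
      apply ccont_mult; auto. now apply ccont_inv.
  - unfold psiRL. fold k. replace ((1 - 0) / (1 + RtoC (2 * k) * 0))%C with (RtoC (1 * 1)).
    2:{ rewrite Rmult_1_l. field. }
    rewrite Csqrt_RtoC_sqr by lra. rewrite Cmult_1_r, <- RtoC_minus. unfold k. f_equal. ring.
  - lra.
  - unfold psiRL. fold k.
    replace ((1 - RtoC (- r)) / (1 + RtoC (2 * k) * RtoC (- r)))%C with (RtoC (Y * Y)).
    2:{ rewrite <- RtoC_minus, <- RtoC_mult, <- RtoC_plus, <- RtoC_div by nra. f_equal.
        apply Rmult_eq_reg_r with (1 + 2 * k * - r); [|nra].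
        transitivity (1 - - r); [|field; nra]. lra. }
    rewrite Csqrt_RtoC_sqr by lra. rewrite <- RtoC_mult, <- RtoC_minus. f_equal.
    fold c. unfold Y. rewrite <- Hdk. unfold k. ring.
  - intros z Hz. apply disk_shift. fold c.
    assert (Hz1 : Cmod z < 1) by lra.
    pose proof (mobius_denominator_neq_0 _ z Hb Hz1) as Hn. pose proof (Re_mobius_pos _ z Hb Hz1) as Hpos.
    unfold psiRL. fold k. set (M := ((1 - z) / (1 + RtoC (2 * k) * z))%C) in *.
    set (y := Csqrt M). assert (Hy : 0 < Re y) by (now apply Csqrt_Re_pos).
    assert (Ey : (y * y = M)%C) by apply Csqrt_sqr.
    set (eta := (y - 1)%C).
    assert (Eu : (RtoC (sqrt 2) - RtoC k * y - 1 = - (RtoC k * eta))%C).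
    { unfold eta. replace (RtoC (sqrt 2)) with (RtoC k + 1)%C.
      - ring.
      - rewrite <- RtoC_plus. unfold k. f_equal. ring. }
    rewrite Eu, Cmod_opp, Cmod_mult, Cmod_R, Rabs_pos_eq by lra.
    enough (Heta : Cmod eta < d) by (rewrite <- Hdk; nra).
    apply Rnot_le_lt; intros Hge.
    assert (Em : (z * (1 + RtoC (2 * k) * (y * y)) = 1 - y * y)%C).
    { rewrite Ey. unfold M. field. auto. }
    assert (Em2 : Cmod (1 - y * y)%C * Cmod (1 - y * y)%C =
      (Cmod z * Cmod z) * (Cmod (1 + RtoC (2 * k) * (y * y))%C * Cmod (1 + RtoC (2 * k) * (y * y))%C)).
    { rewrite <- Em, Cmod_mult. ring. }
    set (X := Re eta). set (dl := Cmod eta) in *.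
    assert (EX : Re y = 1 + X) by (unfold X, eta; rewrite Re_minus, re_RtoC; ring).
    assert (EI : Im y = Im eta) by (unfold eta; rewrite Im_minus, im_RtoC; ring).
    assert (ED : dl * dl = X * X + Im eta * Im eta) by apply Cmod_sqr.
    assert (HX : -1 <= X <= dl).
    { split; [lra|]. unfold X, dl. eapply Rle_trans; [apply Rle_abs|apply re_le_Cmod]. }
    assert (F1 : Cmod (1 - y * y)%C * Cmod (1 - y * y)%C = (dl * dl) * (4 + 4 * X + dl * dl)).
    { rewrite Cmod_sqr, Re_minus, Im_minus, re_mult, im_mult, re_RtoC, im_RtoC, EX, EI, ED. ring. }
    assert (F2 : Cmod (1 + RtoC (2 * k) * (y * y))%C * Cmod (1 + RtoC (2 * k) * (y * y))%C =
      (1 + 2 * k) * (1 + 2 * k) + 16 * k * k * (dl * dl) + 4 * k * k * (dl * dl) * (dl * dl)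
      + 8 * (1 + 2 * k) * k * X + 4 * (1 + 2 * k) * k * (2 * X * X - dl * dl) + 16 * k * k * (dl * dl) * X).
    { rewrite Cmod_sqr, re_plus, im_plus, re_scal_l, im_scal_l, re_mult, im_mult, re_RtoC, im_RtoC, EX, EI, ED. ring. }
    assert (HD : d * d <= dl * dl) by (apply Rmult_le_compat; lra).
    assert (Hd2 : 0.8875 * 0.8875 <= d * d) by (apply Rmult_le_compat; lra).
    assert (Hkr : k * r <= 0.4143 * 0.66) by (apply Rmult_le_compat; lra).
    assert (Hmain : r * r * (Cmod (1 + RtoC (2 * k) * (y * y))%C * Cmod (1 + RtoC (2 * k) * (y * y))%C)
       <= Cmod (1 - y * y)%C * Cmod (1 - y * y)%C).
    { rewrite F1, F2. apply RL_polynomial; try lra.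
      - assert (Hd4 : 2 * d + d * d <= 2 * dl + dl * dl) by lra.
        assert (Hd3 : r * (1 + 2 * k) = (2 * d + d * d) * (1 - 2 * k * r)) by (unfold Y in Er; lra).
        rewrite Hd3. apply Rmult_le_compat_r; lra.
      - assert (Hkd : 0.8284 * 0.7876 <= 2 * k * (dl * dl)) by (apply Rmult_le_compat; lra).
        assert (Hrk : r * (1 + 2 * k - 2 * k * (dl * dl)) <= r * 1.178) by (apply Rmult_le_compat_l; lra).
        lra. }
    rewrite Em2 in Hmain.
    assert (Hne : 0 < Cmod (1 + RtoC (2 * k) * (y * y))%C).
    { apply Cmod_gt_0. intros E'.
      assert (Hyy : (1 - y * y = 0)%C) by (rewrite <- Em, E'; ring).
      assert (E3 : (1 + RtoC (2 * k) = 0)%C).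
      { transitivity ((1 + RtoC (2 * k) * (y * y)) + RtoC (2 * k) * (1 - y * y))%C; [ring|]. rewrite E', Hyy. ring. }
      rewrite <- RtoC_plus in E3. apply RtoC_inj in E3. lra. }
    pose proof (Cmod_ge_0 z). set (N := Cmod (1 + RtoC (2 * k) * (y * y))%C) in *.
    assert (HN : 0 < N * N) by (apply Rmult_lt_0_compat; auto).
    assert (Hzr : Cmod z * Cmod z < r * r) by (apply Rmult_le_0_lt_compat; auto).
    apply Rmult_lt_compat_r with (1 := HN) in Hzr. lra.
Qed.

Lemma exp_le_quadratic x : 0 <= x <= 1 -> exp x <= 1 + x + x ^ 2.
Proof.
  intros Hx. pose proof (exp_opp_ge_3 x ltac:(lra)) as H.
  assert (E : exp x * exp (- x) = 1) by (rewrite <- exp_plus, Rplus_opp_r; apply exp_0).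
  assert (P : 1 <= (1 + x + x ^ 2) * exp (- x)).
  { apply Rle_trans with ((1 + x + x ^ 2) * (1 - x + x ^ 2 / 2 - x ^ 3 / 6)).
    - enough (0 <= x ^ 2 * ((1 - x) * (3 - x + x ^ 2))) by (simpl in *; lra).
      apply Rmult_le_pos; [apply pow2_ge_0|]. apply Rmult_le_pos; [lra|]. simpl; nra.
    - apply Rmult_le_compat_l; [simpl; nra|lra]. }
  pose proof (exp_pos (- x)). nra.
Qed.

Lemma radius_e : is_radius (starlike wp) (starlike psie) (1 - ln (exp 1 - 1)).
Proof.
  pose proof exp_1_bounds as He. pose proof inv_exp_1_bounds as Hi.
  set (r := 1 - ln (exp 1 - 1)). set (m := 1 - / exp 1).
  assert (Hm : 0.632 < m < 0.6323) by (unfold m; lra).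
  assert (Er : exp (- r) = m).
  { unfold r, m. replace (- (1 - ln (exp 1 - 1))) with (- (1) + ln (exp 1 - 1)) by ring.
    rewrite exp_plus, exp_Ropp, exp_ln by lra. field. lra. }
  assert (Hr0 : 0 < r).
  { apply Ropp_lt_cancel. rewrite Ropp_0. apply exp_lt_inv. rewrite Er, exp_0. lra. }
  assert (Hr1 : r < 1 / 2).
  { apply Ropp_lt_cancel. apply exp_lt_inv. rewrite Er.
    eapply Rle_lt_trans; [apply exp_opp_le_2|]; lra. }
  apply is_radius_of_disk with Cexp.
  - intros p _. apply cderiv_Cexp.
  - intros p _. apply cderiv_cont with (Cexp p), cderiv_Cexp.
  - apply Cexp_0.
  - lra.
  - unfold psie. rewrite Cexp_RtoC, Er. reflexivity.
  - intros z Hz. unfold psie. replace (1 + / exp 1) with (2 - m) by (unfold m; ring).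
    apply Cmod_lt_sqr; [lra|]. rewrite Re_minus, Im_minus, Re_Cexp, Im_Cexp, re_RtoC, im_RtoC.
    set (x := Re z). set (y := Im z).
    assert (Hxy : x * x + y * y < r * r).
    { pose proof (Cmod_sqr z) as Hs. fold x y in Hs. pose proof (Cmod_ge_0 z). nra. }
    assert (Hx : - r < x < r) by nra.
    pose (t := x + r). assert (Ht : 0 < t < 1) by (unfold t; lra).
    assert (Ex : exp x = m * exp t).
    { rewrite <- Er, <- exp_plus. f_equal. unfold t. ring. }
    pose proof (exp_le_quadratic t ltac:(lra)) as T1. pose proof (exp_opp_le_2 t ltac:(lra)) as T2.
    pose proof (exp_pos t) as Tp.
    assert (ET : exp t * exp (- t) = 1) by (rewrite <- exp_plus, Rplus_opp_r; apply exp_0).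
    pose proof (cos_ge_2 y) as Hcos.
    assert (Hy : y * y < t * (2 * r - t)) by (unfold t; lra).
    assert (Key : m * exp t + (4 - m) * exp (- t) < 4 * cos y).
    { assert (m * exp t <= m * (1 + t + t ^ 2)) by (apply Rmult_le_compat_l; lra).
      assert ((4 - m) * exp (- t) <= (4 - m) * (1 - t + t ^ 2 / 2)) by (apply Rmult_le_compat_l; lra).
      assert (t * (m / 2) <= 1 * (m / 2)) by (apply Rmult_le_compat_r; lra).
      assert (0 < t * (4 - 2 * m - 4 * r - t * (m / 2))) by (apply Rmult_lt_0_compat; lra).
      simpl in *; lra. }
    assert (Key2 : (m * exp t) * (m * exp t + (4 - m) * exp (- t)) < (m * exp t) * (4 * cos y)).
    { apply Rmult_lt_compat_l; auto. apply Rmult_lt_0_compat; lra. }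
    replace (m * exp t * (m * exp t + (4 - m) * exp (- t)))
      with ((m * exp t) * (m * exp t) + m * (4 - m) * (exp t * exp (- t))) in Key2 by ring.
    rewrite ET in Key2. rewrite Ex.
    generalize (sin2_cos2 y). unfold Rsqr. intros S.
    replace ((m * exp t * cos y - 2) * (m * exp t * cos y - 2) + (m * exp t * sin y - 0) * (m * exp t * sin y - 0))
      with ((m * exp t) * (m * exp t) * (sin y * sin y + cos y * cos y) - (m * exp t) * (4 * cos y) + 4) by ring.
    rewrite S. lra.
Qed.

Lemma radius_C : is_radius (starlike wp) (starlike psiC) (1 - sqrt (1 - 3 / (2 * exp 1))).
Proof.
  pose proof exp_1_bounds as He. pose proof inv_exp_1_bounds as Hi.
  set (c := / exp 1) in *. set (n := sqrt (1 - 3 / (2 * exp 1))).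
  assert (Earg : 1 - 3 / (2 * exp 1) = 1 - 3 / 2 * c) by (unfold c; field; lra).
  assert (En : n * n = 1 - 3 / 2 * c) by (unfold n; rewrite Earg; apply sqrt_sqrt; lra).
  assert (Hn0 : 0 <= n) by apply sqrt_pos.
  assert (Hn : 0.66 < n < 0.68) by (split; nra).
  apply is_radius_of_disk with (fun z => RtoC (4 / 3) + RtoC (2 / 3) * (z + z))%C.
  - intros p _. unfold psiC. eapply cderiv_val; [|apply cderiv_plus; [apply cderiv_plus; [apply cderiv_const|]|]].
    2:{ apply cderiv_scal, cderiv_id. }
    2:{ apply cderiv_scal. apply cderiv_mult; apply cderiv_id. }
    cbv beta. ring.
  - intros p _. apply ccont_plus; [apply ccont_const|]. apply ccont_mult; [apply ccont_const|].
    apply ccont_plus; apply ccont_id.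
  - unfold psiC. ring.
  - lra.
  - fold c. unfold psiC. rewrite <- !RtoC_mult, <- !RtoC_plus. f_equal. lra.
  - intros z Hz. fold c. unfold psiC.
    set (s := Cmod z) in *. pose proof (Cmod_sqr z) as Hs. fold s in Hs.
    assert (Hs0 : 0 <= s) by apply Cmod_ge_0.
    pose proof (re_le_Cmod z) as Hre. fold s in Hre. apply Rabs_le_between in Hre.
    apply Cmod_lt_sqr; [lra|].
    set (x := Re z) in *. set (y := Im z) in *.
    assert (ER : Re (1 + RtoC (4 / 3) * z + RtoC (2 / 3) * (z * z) - 2)%C
       = 2 / 3 * ((1 + x) * (1 + x) - y * y - 5 / 2)).
    { rewrite Re_minus, !re_plus, !re_scal_l, re_mult, !re_RtoC. fold x y. field. }
    assert (EI : Im (1 + RtoC (4 / 3) * z + RtoC (2 / 3) * (z * z) - 2)%C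
       = 2 / 3 * (2 * (1 + x) * y)).
    { rewrite Im_minus, !im_plus, !im_scal_l, im_mult, !im_RtoC. fold x y. field. }
    rewrite ER, EI.
    pose (tau := 1 - s). pose (d := 2 * (s + x)).
    assert (Htau : n < tau <= 1) by (unfold tau; lra). assert (Hd : 0 <= d) by (unfold d; lra).
    (* [|1 + z|^2 = tau^2 + d] *)
    assert (E : (2 / 3 * ((1 + x) * (1 + x) - y * y - 5 / 2)) * (2 / 3 * ((1 + x) * (1 + x) - y * y - 5 / 2))
       + (2 / 3 * (2 * (1 + x) * y)) * (2 / 3 * (2 * (1 + x) * y))
       = 4 / 9 * (tau * tau * (tau * tau) - 5 * (tau * tau) + d * (2 * (tau * tau) + 5 - 10 * tau) - 3 / 2 * (d * d) + 25 / 4)).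
    { replace (y * y) with (s * s - x * x) by lra.
      replace (2 / 3 * (2 * (1 + x) * y) * (2 / 3 * (2 * (1 + x) * y)))
        with (4 / 9 * (4 * ((1 + x) * (1 + x)) * (y * y))) by field.
      replace (y * y) with (s * s - x * x) by lra. unfold tau, d. field. }
    rewrite E.
    assert (D1 : d * (2 * (tau * tau) + 5 - 10 * tau) <= 0).
    { assert (0 <= d * (10 * tau - 5 - 2 * (tau * tau))); [|lra].
      assert (Htt : tau * tau <= tau * 1) by (apply Rmult_le_compat_l; lra).
      apply Rmult_le_pos; lra. }
    assert (Hnt : n * n < tau * tau) by (apply Rmult_le_0_lt_compat; lra).
    assert (Htt : tau * tau <= 1 * 1) by (apply Rmult_le_compat; lra).
    assert (D2 : 0 < (tau * tau - n * n) * (5 - tau * tau - n * n)) by (apply Rmult_lt_0_compat; lra).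
    assert (D3 : 0 <= d * d) by nra.
    replace c with (2 / 3 * (1 - n * n)) by lra.
    lra.
Qed.

Lemma Csin_components (z : C) :
  Re (Csin z) = sin (Re z) * ((exp (Im z) + exp (- Im z)) / 2) /\
  Im (Csin z) = cos (Re z) * ((exp (Im z) - exp (- Im z)) / 2).
Proof.
  destruct z as [x y]. simpl (Re (x, y)). simpl (Im (x, y)).
  assert (E1 : Cexp (Defs.Ci * (x, y))%C = (exp (- y) * cos x, exp (- y) * sin x)).
  { unfold Cexp, Defs.Ci. replace (Re ((0, 1) * (x, y))%C) with (- y) by (simpl; ring).
    replace (Im ((0, 1) * (x, y))%C) with x by (simpl; ring). apply C_eq; simpl; ring. }
  assert (E2 : Cexp (- (Defs.Ci * (x, y)))%C = (exp y * cos x, - (exp y * sin x))).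
  { unfold Cexp, Defs.Ci. replace (Re (- ((0, 1) * (x, y)))%C) with y by (simpl; ring).
    replace (Im (- ((0, 1) * (x, y)))%C) with (- x) by (simpl; ring).
    rewrite cos_neg, sin_neg. apply C_eq; simpl; ring. }
  unfold Csin. rewrite E1, E2. unfold Cdiv.
  replace (/ (2 * Defs.Ci))%C with ((0, - (1 / 2)) : C) by (apply C_eq; simpl; field).
  split; simpl; field.
Qed.

Lemma cosh_le_quadratic y : -1 <= y <= 1 -> (exp y + exp (- y)) / 2 <= 1 + 3 / 4 * (y * y).
Proof.
  assert (P : forall t, 0 <= t <= 1 -> (exp t + exp (- t)) / 2 <= 1 + 3 / 4 * (t * t)).
  { intros t Ht. generalize (exp_le_quadratic t Ht) (exp_opp_le_2 t ltac:(lra)). simpl. lra. }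
  intros Hy. destruct (Rle_dec 0 y); [apply P; lra|].
  generalize (P (- y) ltac:(lra)). rewrite Ropp_involutive. lra.
Qed.

Lemma radius_s : is_radius (starlike wp) (starlike psis) (asin (/ exp 1)).
Proof.
  pose proof exp_1_bounds as He. pose proof inv_exp_1_bounds as Hi.
  set (c := / exp 1) in *. set (r := asin c).
  pose proof PI_4 as Hpi4. pose proof PI2_1 as Hpi.
  assert (Er : sin r = c) by (apply sin_asin; lra).
  assert (Hb : - (PI / 2) <= r <= PI / 2) by apply asin_bound.
  assert (Hr0 : 0 < r).
  { apply sin_increasing_0; try lra. rewrite sin_0, Er. lra. }
  assert (Hr1 : r < 0.4).
  { apply sin_increasing_0; try lra. rewrite Er.
    generalize (sin_ge_3 0.4 ltac:(lra)). simpl. lra. }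
  assert (H2i : (2 * Defs.Ci)%C <> 0%C).
  { apply Cmult_neq_0; intros E.
    - apply RtoC_inj in E. lra.
    - apply (f_equal Im) in E. simpl in E. lra. }
  pose (psi1 := fun z => ((Defs.Ci * Cexp (Defs.Ci * z) - - Defs.Ci * Cexp (- (Defs.Ci * z))) * / (2 * Defs.Ci))%C).
  apply is_radius_of_disk with psi1.
  - intros p _. unfold psis, Csin.
    eapply cderiv_val; [|apply cderiv_plus; [apply cderiv_const|apply cderiv_div; [|apply cderiv_const|exact H2i]]].
    2:{ apply cderiv_minus.
        - apply (cderiv_comp (fun z => Defs.Ci * z)%C Cexp); [apply cderiv_scal, cderiv_id|apply cderiv_Cexp].
        - apply (cderiv_comp (fun z => - (Defs.Ci * z))%C Cexp); [apply cderiv_opp, cderiv_scal, cderiv_id|apply cderiv_Cexp]. }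
    unfold psi1. cbv beta. field. intros E. apply H2i. rewrite E. ring.
  - intros p _.
    assert (Ce : forall q, ccont Cexp q) by (intros q; apply cderiv_cont with (Cexp q), cderiv_Cexp).
    assert (Ci1 : ccont (fun z => Defs.Ci * z)%C p) by (apply ccont_mult; auto using ccont_const, ccont_id).
    apply ccont_mult; [|apply ccont_const]. apply ccont_plus; [|apply ccont_opp];
      apply ccont_mult; try apply ccont_const.
    + now apply (ccont_comp (fun z => Defs.Ci * z)%C Cexp).
    + apply (ccont_comp (fun z => - (Defs.Ci * z))%C Cexp); auto. now apply ccont_opp.
  - unfold psis. destruct (Csin_components 0%C) as [A B]. apply C_eq.
    + rewrite re_plus, A, !re_RtoC, sin_0. ring.
    + rewrite im_plus, B, !im_RtoC, Ropp_0. field.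
  - lra.
  - fold c. unfold psis. destruct (Csin_components (RtoC (- r))) as [A B]. apply C_eq.
    + rewrite re_plus, A, !re_RtoC, im_RtoC, Ropp_0, exp_0, sin_neg, Er. field.
    + rewrite im_plus, B, !im_RtoC, Ropp_0. field.
  - intros z Hz. fold c. unfold psis. destruct (Csin_components z) as [A B].
    pose proof (Cmod_sqr z) as Hs. pose proof (Cmod_ge_0 z) as Hz0.
    apply Cmod_lt_sqr; [lra|]. rewrite Re_minus, Im_minus, re_plus, im_plus, A, B, !re_RtoC, !im_RtoC.
    set (x := Re z) in *. set (y := Im z) in *.
    pose (Ch := (exp y + exp (- y)) / 2). pose (Sh := (exp y - exp (- y)) / 2). fold Ch Sh.
    assert (HCS : Ch * Ch = 1 + Sh * Sh).
    { assert (exp y * exp (- y) = 1) by (rewrite <- exp_plus, Rplus_opp_r; apply exp_0).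
      unfold Ch, Sh. lra. }
    assert (Hxy : x * x + y * y < r * r) by nra.
    assert (Hy : -1 <= y <= 1) by nra.
    pose proof (cosh_le_quadratic y Hy) as HCh. fold Ch in HCh.
    assert (HCh1 : 1 <= Ch).
    { assert (0 < Ch) by (unfold Ch; generalize (exp_pos y) (exp_pos (- y)); lra). nra. }
    generalize (sin2_cos2 x). unfold Rsqr. intros S.
    replace ((1 + sin x * Ch - 2) * (1 + sin x * Ch - 2) + (0 + cos x * Sh - 0) * (0 + cos x * Sh - 0))
      with ((Ch - sin x) * (Ch - sin x)).
    2:{ replace (cos x * Sh) with (Sh * cos x) by ring.
        assert ((0 + Sh * cos x - 0) * (0 + Sh * cos x - 0) = (Ch * Ch - 1) * (1 - sin x * sin x)) as ->.
        { rewrite HCS. replace (1 - sin x * sin x) with (cos x * cos x) by lra. ring. }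
        ring. }
    pose proof (SIN_bound x) as Hsx.
    enough (Ch - sin x < 1 + c) by nra.
    assert (Hxr : - r < x < r) by nra.
    pose (a := Rabs x).
    assert (Ha : 0 <= a < r).
    { unfold a. split; [apply Rabs_pos|]. apply Rabs_def1; lra. }
    assert (Haa : a * a = x * x) by (unfold a; rewrite <- Rabs_mult; apply Rabs_pos_eq; nra).
    assert (Hsin : - sin x <= sin a).
    { unfold a, Rabs. destruct (Rcase_abs x).
      - rewrite sin_neg. lra.
      - assert (0 <= sin x) by (apply sin_ge_0; lra). lra. }
    assert (Hmvt : 0.9 * (r - a) <= sin r - sin a).
    { destruct (MVT_cor2 sin cos a r ltac:(lra)) as [xi [Exi Hxi]].
      - intros t _. apply derivable_pt_lim_sin.
      - rewrite Exi. pose proof (cos_ge_2 xi) as Hc. simpl in Hc.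
        apply Rmult_le_compat_r; [lra|]. nra. }
    assert (Hfin : 3 / 4 * (y * y) < 0.9 * (r - a)).
    { assert (Hya : y * y < (r - a) * (r + a)) by lra.
      assert ((r - a) * (r + a) <= (r - a) * 0.8) by (apply Rmult_le_compat_l; lra). lra. }
    lra.
Qed.

Lemma radius_D : is_radius (starlike wp) (starlike psiD)
    ((2 * exp 1 - 1) / (2 * exp 1 * (exp 1 - 1))).
Proof.
  pose proof exp_1_bounds as He. pose proof inv_exp_1_bounds as Hi.
  set (m := 1 - / exp 1). assert (Hm : 0.632 < m < 0.6323) by (unfold m; lra).
  assert (Hmi : 1.58 < / m < 1.583).
  { split; apply Rmult_lt_reg_r with m; try rewrite Rinv_l; lra. }
  pose (r := (/ m - m) / 2).
  assert (E : (2 * exp 1 - 1) / (2 * exp 1 * (exp 1 - 1)) = r).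
  { unfold r, m. field. repeat split; lra. }
  rewrite E. assert (Hr : 0.47 < r < 0.48) by (unfold r; lra).
  assert (Emm : m * / m = 1) by (apply Rinv_r; lra).
  assert (Hpos : forall z, Cmod z < 1 -> 0 < Re (1 + z * z)%C).
  { intros z Hz. apply Re_1_plus_pos. rewrite Cmod_mult. pose proof (Cmod_ge_0 z). nra. }
  assert (H2 : RtoC 2 <> 0%C) by (intros E'; apply RtoC_inj in E'; lra).
  apply is_radius_of_disk with (fun z => 1 + (z + z) * / (2 * Csqrt (1 + z * z)))%C.
  - intros p Hp. unfold psiD. apply cderiv_plus; [apply cderiv_id|].
    apply (cderiv_comp (fun z => 1 + z * z)%C Csqrt); [|apply cderiv_Csqrt; auto].
    eapply cderiv_val; [|apply cderiv_plus; [apply cderiv_const|apply cderiv_mult; apply cderiv_id]].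
    cbv beta. ring.
  - intros p Hp. apply ccont_plus; [apply ccont_const|]. apply ccont_mult.
    + apply ccont_plus; apply ccont_id.
    + apply ccont_inv; [|apply Cmult_neq_0; auto; apply Csqrt_neq_0; auto].
      apply ccont_mult; [apply ccont_const|].
      apply (ccont_comp (fun z => 1 + z * z)%C Csqrt); [|apply ccont_Csqrt; auto].
      apply ccont_plus; [apply ccont_const|]. apply ccont_mult; apply ccont_id.
  - unfold psiD. rewrite Cmult_0_r, Cplus_0_r, Cplus_0_l. rewrite <- (Rmult_1_l 1) at 1.
    apply Csqrt_RtoC_sqr. lra.
  - lra.
  - unfold psiD. rewrite <- RtoC_mult, <- RtoC_plus.
    replace (1 + - r * - r) with ((/ m + m) / 2 * ((/ m + m) / 2)).
    + rewrite Csqrt_RtoC_sqr by lra. rewrite <- RtoC_plus. f_equal. unfold r, m. field. lra.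
    + unfold r. replace ((/ m + m) / 2 * ((/ m + m) / 2)) with (m * / m + (/ m - m) / 2 * ((/ m - m) / 2)) by (field; lra).
      rewrite Emm. ring.
  - intros z Hz. replace (1 + / exp 1) with (2 - m) by (unfold m; ring).
    assert (Hz1 : Cmod z < 1) by lra. pose proof (Cmod_ge_0 z) as Hz0.
    unfold psiD. set (s := Csqrt (1 + z * z)%C).
    assert (Es : (s * s = 1 + z * z)%C) by apply Csqrt_sqr.
    assert (HsR : 0 < Re s) by (apply Csqrt_Re_pos; auto).
    set (q := (z + s)%C).
    assert (Eq : ((q * q - 1) = 2 * z * q)%C).
    { unfold q. transitivity (z * z + 2 * z * s + s * s - 1)%C; [|rewrite Es];
        replace (RtoC 2) with (1 + 1)%C by (rewrite <- RtoC_plus; f_equal; ring); ring. }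
    set (X := Re q). set (Y := Im q). pose (t := X * X + Y * Y).
    assert (Et : Cmod q * Cmod q = t) by apply Cmod_sqr.
    (* [q (s - z) = 1], so [Re q] and [Re (s - z)] have the same sign, and their sum is [2 Re s]. *)
    assert (HX : 0 < X).
    { assert (E1 : (q * (s - z) = 1)%C) by (unfold q; transitivity (s * s - z * z)%C; [|rewrite Es]; ring).
      pose proof (f_equal Re E1) as R1. pose proof (f_equal Im E1) as I1.
      rewrite re_mult, re_RtoC in R1. rewrite im_mult, im_RtoC in I1. fold X Y in R1, I1.
      set (A := Re (s - z)%C) in *. set (B := Im (s - z)%C) in *.
      assert (HXA : X + A = 2 * Re s) by (unfold X, A, q; rewrite re_plus, Re_minus; ring).
      assert (HA : A * t = X).
      { unfold t. transitivity (X * (X * A - Y * B) + Y * (X * B + Y * A)); [ring|]. rewrite R1, I1. ring. }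
      assert (Ht0 : 0 <= t) by (unfold t; nra).
      apply Rnot_le_lt; intros Hle. assert (HA0 : 0 < A) by lra.
      assert (0 <= A * t) by (apply Rmult_le_pos; lra).
      assert (HX0 : X = 0) by lra. rewrite HX0 in HA, R1.
      apply Rmult_integral in HA as [HA|HA]; [lra|]. unfold t in HA. rewrite HX0 in HA.
      assert (HY0 : Y = 0) by (apply Rsqr_0_uniq; unfold Rsqr; lra).
      rewrite HY0 in R1. lra. }
    assert (Ht : 0 < t) by (unfold t; nra).
    assert (N1 : Cmod (q * q - 1)%C * Cmod (q * q - 1)%C = (t + 1) * (t + 1) - 4 * (X * X)).
    { rewrite Cmod_sqr, Re_minus, Im_minus, re_mult, im_mult, re_RtoC, im_RtoC. fold X Y. unfold t. ring. }
    assert (N2 : (t + 1) * (t + 1) - 4 * (X * X) < 4 * (r * r) * t).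
    { rewrite <- N1, Eq, !Cmod_mult, Cmod_R, Rabs_pos_eq by lra. rewrite <- Et.
      replace (2 * Cmod z * Cmod q * (2 * Cmod z * Cmod q)) with (4 * (Cmod z * Cmod z) * (Cmod q * Cmod q)) by ring.
      rewrite Et. apply Rmult_lt_compat_r; auto. nra. }
    assert (Err : 4 * (r * r) = / m * / m + m * m - 2).
    { unfold r. transitivity (/ m * / m + m * m - 2 * (m * / m)); [field; lra|]. rewrite Emm. ring. }
    assert (HXt : X * X <= t) by (unfold t; nra).
    assert (Hmm : m * m < t).
    { assert ((t - m * m) * (t - / m * / m) < 0).
      { replace ((t - m * m) * (t - / m * / m)) with (t * t - (m * m + / m * / m) * t + (m * / m) * (m * / m)) by ring.
        rewrite Emm. rewrite Err in N2. lra. }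
      assert (m * m < / m * / m) by nra. nra. }
    pose (b := 4 * m - m * m).
    assert (Hb : 2 < b) by (unfold b; nra).
    assert (K1 : (t + b) * (t + b) < 16 * (X * X)).
    { assert (F : 4 * ((t + 1) * (t + 1) - 4 * (r * r) * t) - (t + b) * (t + b)
        = (t - m * m) * (3 * t + (b * b - 4) * (/ m * / m))).
      { rewrite Err. unfold b.
        replace ((t - m * m) * (3 * t + ((4 * m - m * m) * (4 * m - m * m) - 4) * (/ m * / m)))
          with ((t - m * m) * (3 * t + (4 - m) * (4 - m) * ((m * / m) * (m * / m)) - 4 * (/ m * / m))) by ring.
        rewrite Emm.
        replace ((t - m * m) * (3 * t + (4 - m) * (4 - m) * (1 * 1) - 4 * (/ m * / m)))
          with (3 * t * t + (4 - m) * (4 - m) * t - 4 * (/ m * / m) * t - 3 * t * (m * m)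
                - (4 - m) * (4 - m) * (m * m) + 4 * ((m * / m) * (m * / m))) by ring.
        rewrite Emm. ring. }
      assert (0 < (t - m * m) * (3 * t + (b * b - 4) * (/ m * / m))).
      { apply Rmult_lt_0_compat; [lra|]. assert (0 < (b * b - 4) * (/ m * / m)).
        { apply Rmult_lt_0_compat; [nra|apply Rmult_lt_0_compat; lra]. }
        lra. }
      lra. }
    assert (K2 : t + b < 4 * X) by (apply Rsqr_incrst_0; unfold Rsqr; lra).
    apply Cmod_lt_sqr; [lra|]. rewrite Re_minus, Im_minus, re_RtoC, im_RtoC. fold X Y.
    unfold t, b in K2. lra.
Qed.

Theorem mainTheorem11 :
  is_radius (starlike wp) (starlike psiL) ((2 * exp 1 - 1) / (exp 1 ^ 2)) /\
  is_radius (starlike wp) (starlike psiRL)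
    ((1 + 2 * (sqrt 2 - 1) * exp 1) /
     (exp 1 ^ 2 * (sqrt 2 - 1) *
      (sqrt 2 - 1 + 2 * (sqrt 2 - 1 + / exp 1) ^ 2))) /\
  is_radius (starlike wp) (starlike psie) (1 - ln (exp 1 - 1)) /\
  is_radius (starlike wp) (starlike psiC) (1 - sqrt (1 - 3 / (2 * exp 1))) /\
  is_radius (starlike wp) (starlike psis) (asin (/ exp 1)) /\
  is_radius (starlike wp) (starlike psiD)
    ((2 * exp 1 - 1) / (2 * exp 1 * (exp 1 - 1))).
Proof.
  split; [exact radius_L|]. split; [exact radius_RL|]. split; [exact radius_e|].
  split; [exact radius_C|]. split; [exact radius_s|exact radius_D].
Qed.
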